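(* Let $N$ be a compact, connected, $n$-dimensional, minimal and totally real submanifold of a $2n$-dimensional (real dimension) Kählerian manifold $M$. Then $N$ is stable as a minimal submanifold if and only if $$\int_N\{\|\nabla u\|^2+R^N(u,u)-R^M(u,u)\}*1$$ is nonnegative for every tangent vector field $u$ on $N$, where $\nabla$ denotes the (tangential) Levi-Civita connection of $N$ and $R^M$ and $R^N$ denote the Ricci forms (Ricci tensors) of $M$ and $N$, respectively.
   Context: A submanifold $N$ of a Kählerian manifold $M$ with complex structure $J$ is totally real if $J(TN)$ is a subbundle of the normal bundle $T^\perp N$. A compact minimal submanifold $N$ of a Riemannian manifold $M$ is stable if the second variation of volume is nonnegative for every normal vector field $v$ on $N$, i.e. $\int_N\{\|\nabla v\|^2-R(v,v)-\|Bv\|^2\}*1\ge0$, where here $\nabla$ is the normal connection, $R(v,v)=\sum_i\langle K^M(e_i,v)v,e_i\rangle$ for an orthonormal basis $(e_i)$ of $T_xN$ with $K^M$ the curvature tensor of $M$, and $B$ is the second fundamental form. $*1$ is the volume element of $N$. *)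

(* Defs.v *)
From mathcomp Require Import all_boot all_order all_algebra.
From mathcomp Require Import all_classical all_reals all_analysis.
Set Implicit Arguments.
Unset Strict Implicit.
Unset Printing Implicit Defensive.
Import Order.TTheory GRing.Theory Num.Theory.
Import numFieldNormedType.Exports.
Local Open Scope classical_set_scope.
Local Open Scope ring_scope.

(* Tensor calculus in local coordinates. Tangent vectors are row vectors of
   components with respect to a chart, linear maps act on them on the right,
   and a tensor field is a family of components indexed by the charts, obeying
   the usual transformation rule. *)

(* The values of [lcoord c] outside of [dom c], and of [param c] outside of
   [lcoord c @` dom c], are irrelevant. [chart_at p] is some chart around [p];
   it is only used to evaluate scalars that are independent of the chart.
   Manifolds are nonempty (the carrier is pointed). *)
Record charted_space (R : realType) (n : nat) := ChartedSpace {
  carrier :> ptopologicalType;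
  chart : Type;
  dom : chart -> set carrier;
  lcoord : chart -> carrier -> 'rV[R]_n;
  param : chart -> 'rV[R]_n -> carrier;
  chart_at : carrier -> chart;
  mem_chart_at : forall p, dom (chart_at p) p;
  open_dom : forall c, open (dom c);
  open_codom : forall c, open (lcoord c @` dom c);
  lcoordK : forall c p, dom c p -> param c (lcoord c p) = p;
  lcoord_continuous : forall c, {in dom c, continuous (lcoord c)};
  param_continuous : forall c, {in lcoord c @` dom c, continuous (param c)}
}.

(* Partial derivative along the i-th coordinate of the chart c; it only
   depends on the germ of F at p when p is in the domain of c. *)
Definition pd (R : realType) (n : nat) (X : charted_space R n) (c : chart X)
    (i : 'I_n) (F : X -> R) (p : X) : R :=
  'D_(delta_mx 0 i) (F \o param c) (lcoord c p).

(* F is C^oo on the open subset A of [dom c]: all its iterated partial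
   derivatives exist and are differentiable (hence continuous) on A. *)
Definition smooth_on (R : realType) (n : nat) (X : charted_space R n)
    (c : chart X) (A : set X) (F : X -> R) : Prop :=
  forall (s : seq 'I_n) (p : X), A p ->
    differentiable (foldr (pd c) F s \o param c) (lcoord c p).

(* Matrix of the differential of f at p: its row i consists of the components
   in the chart d of the image of the i-th coordinate vector of the chart c.
   For [f = id] this is the change of components from c to d. *)
Definition dmap (R : realType) (n m : nat) (X : charted_space R n)
    (Y : charted_space R m) (f : X -> Y) (c : chart X) (d : chart Y) (p : X) :
    'M[R]_(n, m) :=
  \matrix_(i, k) pd c i (fun q => lcoord d (f q) 0 k) p.

Definition smooth_map (R : realType) (n m : nat) (X : charted_space R n)
    (Y : charted_space R m) (f : X -> Y) : Prop :=
  continuous f /\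
  forall (c : chart X) (d : chart Y) (k : 'I_m),
    smooth_on c (dom c `&` f @^-1` dom d) (fun q => lcoord d (f q) 0 k).

Record manifold (R : realType) (n : nat) := Manifold {
  space :> charted_space R n;
  hausdorff_manifold : hausdorff_space space;
  second_countable_manifold : @second_countable space;
  smooth_transition : smooth_map (@id space)
}.

Definition vector_field (R : realType) (n : nat) (X : manifold R n)
    (u : chart X -> X -> 'rV[R]_n) : Prop :=
  (forall c k, smooth_on c (dom c) (fun q => u c q 0 k)) /\
  (forall c d p, dom c p -> dom d p -> u d p = u c p *m dmap id c d p).

Record riemannian_manifold (R : realType) (n : nat) := RiemannianManifold {
  base :> manifold R n;
  metric : chart base -> base -> 'M[R]_n;
  metric_smooth : forall c i j, smooth_on c (dom c) (fun q => metric c q i j);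
  metric_change : forall c d p, dom c p -> dom d p ->
    metric c p = dmap id c d p *m metric d p *m (dmap id c d p)^T;
  metric_sym : forall c p, dom c p -> (metric c p)^T = metric c p;
  metric_pos : forall c p (v : 'rV[R]_n), dom c p -> v != 0 ->
    0 < (v *m metric c p *m v^T) 0 0
}.

Section riemannian.
Variables (R : realType) (n : nat) (X : riemannian_manifold R n).
Implicit Types (c : chart X) (p : X) (v w : 'rV[R]_n) (i j k l : 'I_n).

Definition inner c p v w : R := (v *m metric c p *m w^T) 0 0.

Definition sqnorm c p v : R := inner c p v v.

(* The rows are an orthonormal basis of the tangent space at p, chosen
   arbitrarily: the sums below are independent of this choice. *)
Definition frame c p : 'M[R]_n :=
  get [set E : 'M[R]_n | E *m metric c p *m E^T = 1%:M].

(* Levi-Civita connection: the k-th component of nabla_{d_i} d_j. *)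
Definition christoffel c i j k p : R :=
  2^-1 * \sum_l (pd c i (fun q => metric c q j l) p
                 + pd c j (fun q => metric c q i l) p
                 - pd c l (fun q => metric c q i j) p)
                * invmx (metric c p) l k.

(* Row i is nabla_{d_i} u. *)
Definition nabla c (u : chart X -> X -> 'rV[R]_n) p : 'M[R]_n :=
  \matrix_(i, k) (pd c i (fun q => u c q 0 k) p
                  + \sum_j u c p 0 j * christoffel c i j k p).

(* The l-th component of K(d_i, d_j) d_k, where
   K(X, Y) Z = nabla_X nabla_Y Z - nabla_Y nabla_X Z - nabla_[X, Y] Z. *)
Definition curvature_coef c i j k l p : R :=
  pd c i (christoffel c j k l) p - pd c j (christoffel c i k l) p
  + \sum_a (christoffel c j k a p * christoffel c i a l p
            - christoffel c i k a p * christoffel c j a l p).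

Definition curvature c p (x y z : 'rV[R]_n) : 'rV[R]_n :=
  \row_l \sum_i \sum_j \sum_k
    x 0 i * y 0 j * z 0 k * curvature_coef c i j k l p.

Definition ricci c p v w : R :=
  \sum_i inner c p (curvature c p (row i (frame c p)) v w)
                   (row i (frame c p)).

(* || nabla u ||^2, the sum of ||nabla_{e_i} u||^2 over an orthonormal basis *)
Definition nabla_sqnorm c (u : chart X -> X -> 'rV[R]_n) p : R :=
  \sum_i sqnorm c p (row i (frame c p *m nabla c u p)).

End riemannian.

(* An almost Hermitian manifold with nabla J = 0, where J X = X *m cstruct;
   J is then integrable, as the Levi-Civita connection is torsion-free. *)
Record kaehler_manifold (R : realType) (m : nat) := KaehlerManifold {
  riem :> riemannian_manifold R m;
  cstruct : chart riem -> riem -> 'M[R]_m;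
  cstruct_smooth : forall c i j,
    smooth_on c (dom c) (fun q => cstruct c q i j);
  cstruct_change : forall c d p, dom c p -> dom d p ->
    cstruct c p *m dmap id c d p = dmap id c d p *m cstruct d p;
  cstruct_sqr : forall c p, dom c p -> cstruct c p *m cstruct c p = - 1%:M;
  cstruct_hermitian : forall c p v w, dom c p ->
    inner c p (v *m cstruct c p) (w *m cstruct c p) = inner c p v w;
  (* nabla_{d_i} (J d_j) = J (nabla_{d_i} d_j) *)
  cstruct_parallel : forall c p i j k, dom c p ->
    pd c i (fun q => cstruct c q j k) p
      + \sum_a cstruct c p j a * christoffel c i a k p
    = \sum_a christoffel c i j a p * cstruct c p a k
}.

(* The n-dimensional Lebesgue integral of a nonnegative Borel function, as an
   iterated integral. *)
Fixpoint lebesgue_iint (R : realType) (n : nat) :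
    ('rV[R]_n -> \bar R) -> \bar R :=
  match n return ('rV[R]_n -> \bar R) -> \bar R with
  | 0 => fun F => F 0
  | n'.+1 => fun F =>
      (\int[@lebesgue_measure R]_(t in setT)
         lebesgue_iint (fun y : 'rV[R]_n' =>
           F (row_mx (t%:M : 'rV[R]_1) y : 'rV[R]_(1 + n'))))%E
  end.

Definition borel (T : ptopologicalType) := g_sigma_algebraType (@open T).

(* mu is the Riemannian volume measure: its density in local coordinates is
   sqrt (det (g_ij)). *)
Definition riemannian_volume (R : realType) (n : nat)
    (N : riemannian_manifold R n) (mu : {measure set (borel N) -> \bar R}) :
    Prop :=
  forall (c : chart N) (A : set (borel N)), measurable A -> A `<=` dom c ->
    mu A = lebesgue_iint (fun x : 'rV[R]_n =>
      (\1_(lcoord c @` A) x * Num.sqrt (\det (metric c (param c x))))%:E).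

Section submanifold.
Variables (R : realType) (n m : nat).
Variables (N : riemannian_manifold R n) (M : riemannian_manifold R m).
Variable f : N -> M.
Implicit Types (c : chart N) (d : chart M) (p : N).

(* f is the inclusion of a submanifold and N carries the induced metric.
   Immersivity follows from the positivity of the metric of N. *)
Definition submanifold : Prop :=
  [/\ injective f, smooth_map f &
      forall c d p, dom c p -> dom d (f p) ->
        metric c p = dmap f c d p *m metric d (f p) *m (dmap f c d p)^T].

(* Components in M of an orthonormal basis of T_p N. *)
Definition tframe c d p : 'M[R]_(n, m) := frame c p *m dmap f c d p.

Definition normal_part c d p (w : 'rV[R]_m) : 'rV[R]_m :=
  w - \sum_i inner d (f p) w (row i (tframe c d p)) *: row i (tframe c d p).

(* A smooth section of the pull-back of the tangent bundle of M, orthogonal to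
   the tangent spaces of N. *)
Definition normal_field (v : chart M -> N -> 'rV[R]_m) : Prop :=
  [/\ forall c d k,
        smooth_on c (dom c `&` f @^-1` dom d) (fun q => v d q 0 k),
      forall d d' p, dom d (f p) -> dom d' (f p) ->
        v d' p = v d p *m dmap id d d' (f p) &
      forall c d p (x : 'rV[R]_n), dom c p -> dom d (f p) ->
        inner d (f p) (v d p) (x *m dmap f c d p) = 0].

(* Row i is nabla^M_{d_i} w, for a vector field w along f given by its
   components in the chart d. *)
Definition nabla_along c d (w : N -> 'rV[R]_m) p : 'M[R]_(n, m) :=
  \matrix_(i, k) (pd c i (fun q => w q 0 k) p
    + \sum_a \sum_b dmap f c d p i a * w p 0 b * christoffel d a b k (f p)).

(* Gauss formula: B(X, Y) is the normal part of nabla^M_X Y. *)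
Definition second_form c d p (x y : 'rV[R]_n) : 'rV[R]_m :=
  normal_part c d p
    (\sum_i \sum_j (x 0 i * y 0 j) *:
       row i (nabla_along c d (fun q => row j (dmap f c d q)) p)).

Definition minimal : Prop :=
  forall c d p, dom c p -> dom d (f p) ->
    \sum_i second_form c d p (row i (frame c p)) (row i (frame c p)) = 0.

(* || nabla^perp v ||^2 *)
Definition normal_nabla_sqnorm c d (v : chart M -> N -> 'rV[R]_m) p : R :=
  \sum_i sqnorm d (f p) (normal_part c d p
    (row i (frame c p *m nabla_along c d (v d) p))).

(* Sum of <K^M(e_i, v) v, e_i> over an orthonormal basis of T_p N. *)
Definition partial_ricci c d p (v : 'rV[R]_m) : R :=
  \sum_i inner d (f p) (curvature d (f p) (row i (tframe c d p)) v v)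
                       (row i (tframe c d p)).

(* || B v ||^2, where B v is the shape operator in the direction v, i.e. the
   bilinear form (X, Y) |-> <B(X, Y), v>. *)
Definition second_form_sqnorm c d p (v : 'rV[R]_m) : R :=
  \sum_i \sum_j inner d (f p)
    (second_form c d p (row i (frame c p)) (row j (frame c p))) v ^+ 2.

Definition second_variation_density (v : chart M -> N -> 'rV[R]_m) p : R :=
  let c := chart_at p in let d := chart_at (f p) in
  normal_nabla_sqnorm c d v p - partial_ricci c d p (v d p)
  - second_form_sqnorm c d p (v d p).

Definition stable (mu : {measure set (borel N) -> \bar R}) : Prop :=
  forall v, normal_field v ->
    (0 <= \int[mu]_(p in setT) (second_variation_density v p)%:E)%E.

Definition tangent_density (u : chart N -> N -> 'rV[R]_n) p : R :=
  let c := chart_at p in let d := chart_at (f p) in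
  nabla_sqnorm c u p + ricci c p (u c p) (u c p)
  - ricci d (f p) (u c p *m dmap f c d p) (u c p *m dmap f c d p).

End submanifold.

(* J maps tangent vectors of N to normal vectors. *)
Definition totally_real (R : realType) (n m : nat)
    (N : riemannian_manifold R n) (M : kaehler_manifold R m) (f : N -> M) :
    Prop :=
  forall (c : chart N) (d : chart M) (p : N) (x y : 'rV[R]_n),
    dom c p -> dom d (f p) ->
    inner d (f p) (x *m dmap f c d p *m cstruct d (f p)) (y *m dmap f c d p)
    = 0.

(* Main.v *)
From HB Require Import structures.
Require Import Defs.
From mathcomp Require Import all_boot all_order all_algebra.
From mathcomp Require Import all_classical all_reals all_analysis.
From mathcomp Require Import ring lra.
Set Implicit Arguments.
Unset Strict Implicit.
Unset Printing Implicit Defensive.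
Import Order.TTheory GRing.Theory Num.Theory.
Import numFieldNormedType.Exports.
Local Open Scope classical_set_scope.
Local Open Scope ring_scope.

(** The map u |-> Ju is a bijection from the tangent to the normal vector fields
    of N: J maps tangent vectors to normal ones as N is totally real, and onto
    since N has half the dimension of M. The theorem follows from the pointwise
    equality of the second variation density of v = Ju with the density
    ||nabla u||^2 + R^N(u, u) - R^M(u, u).

    Let (e_i) be an orthonormal basis of T_p N; then (e_i, Je_i) is one of
    T_p M ([lagrangian_gram]). The equality is the sum of the following ones.

    - || nabla^perp (Ju) || = || nabla u ||, as J is parallel and exchanges
      tangent and normal vectors ([normal_nabla_sqnormE]).
    - ||B_{Ju}||^2 = sum_i ||B(e_i, u)||^2, as <B(X, Y), JZ> is symmetric in all
      its arguments ([second_real], [second_form_sqnormE]).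
    - R^N(u, u) = sum_i <K^M(e_i, u) u, e_i> - sum_i ||B(e_i, u)||^2, by the
      Gauss equation and minimality ([gauss_equation], [ricci_gauss]).
    - R^M(u, u) = sum_i <K^M(e_i, u) u, e_i> + sum_i <K^M(e_i, Ju) Ju, e_i>, by
      the identity <K(JX, Y) Y, JX> = <K(X, JY) JY, X> for the curvature of a
      Kaehler manifold ([kaehler_curvature], [ricci_lagrangian]).

    The Gauss equation and the symmetries of the curvature come from the
    symmetry of second derivatives ([derive_comm], [pd_mx_comm]). They are
    derived from the structure equations satisfied near a point by matrices of
    functions in a chart c of N and a chart d of M: for the connection matrices
    [chris_mx] of M, their pull-backs [pull_chris] to N and the metrics, these
    are the compatibility with the metric and with J and the absence of torsion.
    Vectors are rows, so that linear maps multiply on the right. *)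

(** * Symmetry of second derivatives *)

Section second_derivatives.
Variables (R : realType) (V : normedModType R).
Implicit Types (F : V -> R) (x u v : V).

Lemma is_derive_line F x v (t : R) : differentiable F (t *: v + x) ->
  is_derive t 1 (fun h : R => F (h *: v + x)) ('D_v F (t *: v + x)).
Proof.
move=> dF.
have dl : differentiable (fun h : R => h *: v + x) t by [].
have dc : differentiable (fun h : R => F (h *: v + x)) t.
  exact: (differentiable_comp dl dF).
apply: DeriveDef; first exact: diff_derivable.
rewrite !deriveE // (diff_comp dl dF) /=; congr ('d F _ _).
rewrite [X in 'd X _](_ : _ = ( *:%R ^~ v) + cst x) // diff_val.
by rewrite addrfctE /= scale1r addr0.
Qed.

Definition second_difference F x u v (h : R) : R :=
  F (h *: u + (h *: v + x)) - F (h *: u + x) - F (h *: v + x) + F x.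

(** The mean value theorem on [0, 1] for
    t |-> F (x + t h u + h v) - F (x + t h u), whose increment is the second
    difference. Parametrizing by [0, 1] treats both signs of h at once. *)
Lemma second_difference_mean F x u v (h : R) :
  (forall t s : R, 0 <= t <= 1 -> 0 <= s <= 1 ->
     differentiable F ((t * h) *: u + ((s * h) *: v + x))) ->
  exists2 t : R, 0 < t < 1 & second_difference F x u v h =
    h * ('D_u F ((t * h) *: u + (h *: v + x)) - 'D_u F ((t * h) *: u + x)).
Proof.
move=> dF.
pose phi (t : R) := F (t *: (h *: u) + (h *: v + x)) - F (t *: (h *: u) + x).
pose dphi (t : R) := 'D_(h *: u) F (t *: (h *: u) + (h *: v + x))
  - 'D_(h *: u) F (t *: (h *: u) + x).
have dF1 (t : R) : 0 <= t <= 1 -> differentiable F (t *: (h *: u) + (h *: v +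
  x)).
  by move=> t01; have := dF t 1 t01; rewrite scalerA mul1r; apply; rewrite
    ler01 lexx.
have dF0 (t : R) : 0 <= t <= 1 -> differentiable F (t *: (h *: u) + x).
  by move=> t01; have := dF t 0 t01; rewrite scalerA mul0r scale0r add0r;
    apply; rewrite ler01 lexx.
have iphi (t : R) : 0 <= t <= 1 -> is_derive t 1 phi (dphi t).
  move=> t01; apply: is_deriveB; apply: is_derive_line; [exact: dF1|exact: dF0].
have [||t] := @MVT R phi dphi 0 1 ltr01.
- move=> t; rewrite in_itv/= => /andP[t0 t1]; apply: iphi; lra.
- apply: continuous_in_subspaceT => t; rewrite inE/= in_itv/= => t01.
  apply: differentiable_continuous; apply/derivable1_diffP.
  by have [] := iphi t t01.
rewrite in_itv/= => t01; rewrite subr0 mulr1 => e.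
have t01' : 0 <= t <= 1 by lra.
exists t => //.
rewrite -[RHS]/(h * _) mulrBr.
have DZ y : differentiable F y -> h * 'D_u F y = 'D_(h *: u) F y.
  by move=> dy; rewrite !deriveE // linearZ.
rewrite !DZ; first last.
- by rewrite -scalerA; apply: dF1.
- by rewrite -scalerA; apply: dF0.
rewrite -!scalerA -/(dphi t) -e /phi !scale1r !scale0r !add0r
  /second_difference.
ring.
Qed.


(** By differentiability of the derivative along u at x, the increment in the
    mean value formula is h times its differential at v, up to o(h). *)
Lemma second_difference_approx F x u v :
  (\forall y \near x, differentiable F y) -> differentiable ('D_u F) x ->
  forall e : R, 0 < e -> \forall h \near (0 : R)^',
    `|second_difference F x u v h / h ^+ 2 - 'D_v ('D_u F) x| <= e.
Proof.
move=> dF dG e e0.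
set G : V -> R := 'D_u F; set L : V -> R := 'd G x.
(* bounds the sizes of u + v and of u together; adding 1 makes it positive *)
pose C := `|u| *+ 2 + `|v| + 1.
have uv0 : 0 <= `|u| *+ 2 + `|v| by rewrite addr_ge0 ?mulrn_wge0.
have C0 : 0 < C by rewrite /C; lra.
have eC : 0 < e / C by rewrite divr_gt0.
have HG : \forall k \near (0 : V), `|G (k + x) - G x - L k| <= e / C * `|k|.
  have /eqaddoP/(_ _ eC) := diff_locally dG; apply: filterS => k /=.
  by rewrite !fctE /= opprD addrA.
have HF : \forall k \near (0 : V), differentiable F (k + x).
  by move: dF; rewrite (near_shift 0) subr0; apply.
have [r /= r0 Hr] := nbhs_norm0P.1 (filterI HG HF).
have {}HF k : `|k| < r -> differentiable F (k + x) by move=> /Hr [].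
have {}HG k : `|k| < r -> `|G (k + x) - G x - L k| <= e / C * `|k|.
  by move=> /Hr [].
near=> h.
have h0 : h != 0 by near: h; exact: nbhs_dnbhs_neq.
have hr : `|h| < r / C by near: h; apply: dnbhs0_lt; rewrite divr_gt0.
have {}hr : `|h| * C < r by rewrite -ltr_pdivlMr.
have bd (t s : R) : 0 <= t <= 1 -> 0 <= s <= 1 ->
    `|(t * h) *: u + (s * h) *: v| <= `|h| * (`|u| + `|v|).
  move=> /andP[t0 t1] /andP[s0 s1]; apply: le_trans (ler_normD _ _) _.
  rewrite !normrZ (ger0_norm t0) (ger0_norm s0) mulrDr.
  by rewrite lerD // ler_wpM2r // ler_piMl.
have bC : `|h| * (`|u| + `|v|) <= `|h| * C.
  rewrite ler_wpM2l // /C; have := normr_ge0 u; lra.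
have [t s t01 s01|t /andP[t0 t1] ->] := @second_difference_mean F x u v h.
  by rewrite addrA; apply: HF; rewrite (le_lt_trans (bd _ _ _ _)) //
    (le_lt_trans bC).
set k1 := (t * h) *: u + h *: v; set k2 := (t * h) *: u.
have t01 : 0 <= t <= 1 by rewrite !ltW.
have b1 : `|k1| <= `|h| * (`|u| + `|v|).
  by have := bd t 1 t01; rewrite mul1r; apply; rewrite ler01 lexx.
have b2 : `|k2| <= `|h| * `|u|.
  by rewrite /k2 !normrZ ler_wpM2r // ler_piMl // ger0_norm // ltW.
have r1 := HG k1 (le_lt_trans b1 (le_lt_trans bC hr)).
have bC2 : `|h| * `|u| <= `|h| * (`|u| + `|v|) by rewrite ler_wpM2l // lerDl.
have r2 := HG k2 (le_lt_trans b2 (le_lt_trans bC2 (le_lt_trans bC hr))).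
rewrite addrA -/k1 -/k2 (deriveE v dG) -/L.
have Lk : L k1 - L k2 = h * L v by rewrite -linearB /k1 addrC addKr linearZ.
have -> : h * (G (k1 + x) - G (k2 + x)) / h ^+ 2 - L v
   = ((G (k1 + x) - G x - L k1) - (G (k2 + x) - G x - L k2)) / h.
  have -> : L v = (L k1 - L k2) / h by rewrite Lk mulrC mulKf.
  by field.
rewrite normrM normrV ?unitfE // ler_pdivrMr ?normr_gt0 //.
rewrite (le_trans (ler_normB _ _)) // (le_trans (lerD r1 r2)) // -mulrDr.
rewrite -mulrA ler_pM2l // ler_pdivrMl // mulrC.
rewrite (le_trans (lerD b1 b2)) // -mulrDr ler_wpM2l // /C; lra.
Unshelve. all: by end_near. Qed.

(** Both mixed derivatives are the limit of the same second difference, by the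
    mean value theorem along u, respectively along v. *)
Lemma derive_comm F x u v :
  (\forall y \near x, differentiable F y) ->
  differentiable ('D_u F) x -> differentiable ('D_v F) x ->
  'D_v ('D_u F) x = 'D_u ('D_v F) x.
Proof.
move=> dF du dv.
have sym h : second_difference F x u v h = second_difference F x v u h.
  rewrite /second_difference !addrA (addrC (h *: u) (h *: v)); ring.
pose q h := second_difference F x u v h / h ^+ 2.
have lim1 : q h @[h --> 0^'] --> 'D_v ('D_u F) x.
  apply/cvgrPdist_le => e e0; have := second_difference_approx v dF du e0.
  by apply: filterS => h; rewrite distrC.
have lim2 : q h @[h --> 0^'] --> 'D_u ('D_v F) x.
  apply/cvgrPdist_le => e e0; have := second_difference_approx u dF dv e0.
  by apply: filterS => h; rewrite distrC /q sym.
exact: (cvg_unique _ lim1 lim2).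
Qed.


End second_derivatives.

(** * Germs and the chain rule in coordinates *)

Section differentiability.
Variables (R : realType) (V W : normedModType R).

Lemma differentiable_near_eq (f g : V -> W) x :
  {near x, f =1 g} -> differentiable f x -> differentiable g x.
Proof.
move=> fg /diff_locallyP[dc df].
have dg : g \o shift x = cst (g x) + 'd f x +o_ 0 id.
  apply/eqaddoP => e e0.
  move/eqaddoP: df => /(_ e e0) df.
  have fg0 : \forall k \near (0 : V), f (k + x) = g (k + x).
    by have := near_shift 0 x (fun y => f y = g y); rewrite subr0 => <-.
  apply: filterS2 df fg0 => k; rewrite !fctE /= => + fgk.
  by rewrite fgk (nbhs_singleton fg).
apply/diff_locallyP; by rewrite (diff_unique dc dg).
Qed.

End differentiability.

Section row_vector_valued.
Variables (R : realType) (V : normedModType R) (m : nat).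
Implicit Types (g : V -> 'rV[R]_m).

Lemma differentiable_rV g x :
  (forall k, differentiable (fun y => g y 0 k) x) -> differentiable g x.
Proof.
move=> dg; have -> : g = \sum_k (fun y => g y 0 k *: delta_mx 0 k).
  by apply/funext => y; rewrite fct_sumE [LHS]row_sum_delta.
by apply: differentiable_sum => k; apply: differentiableZl.
Qed.

Lemma derive_comp_rV (H : 'rV[R]_m -> R) g x v :
  (forall k, differentiable (fun y => g y 0 k) x) -> differentiable H (g x) ->
  'D_v (H \o g) x
  = \sum_k 'D_v (fun y => g y 0 k) x * 'D_(delta_mx 0 k) H (g x).
Proof.
move=> dgk dH; have dg := differentiable_rV dgk.
rewrite deriveE; last exact: differentiable_comp.
rewrite (diff_comp dg dH) /= -(deriveE v dg) derive_mx; last exact: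
  diff_derivable.
rewrite [X in 'd H _ X]row_sum_delta linear_sum; apply: eq_bigr => k _.
by rewrite linearZ /= mxE -(deriveE _ dH).
Qed.

End row_vector_valued.

(** * Functions on a charted space *)

Definition open_in (R : realType) (n : nat) (X : charted_space R n)
    (c : chart X) (A : set X) : Prop := open A /\ A `<=` dom c.

Definition pdiff (R : realType) (n : nat) (X : charted_space R n)
    (c : chart X) (F : X -> R) (p : X) : Prop :=
  differentiable (F \o param c) (lcoord c p).

Section chart.
Variables (R : realType) (n : nat) (X : charted_space R n) (c : chart X).
Implicit Types (F G : X -> R) (p q : X) (A : set X).

Lemma open_in_dom : open_in c (dom c).
Proof. by split; [exact: open_dom|]. Qed.

Lemma near_param p (P : X -> Prop) : dom c p ->
  (\forall q \near p, P q) -> \forall x \near lcoord c p, P (param c x).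
Proof.
move=> cp Pp; have := @param_continuous _ _ X c (lcoord c p).
rewrite inE => /(_ (ex_intro2 _ _ p cp erefl)) => H.
by apply: H; rewrite lcoordK.
Qed.

Lemma near_codom p : dom c p ->
  \forall x \near lcoord c p, dom c (param c x) /\ lcoord c (param c x) = x.
Proof.
move=> cp; have : nbhs (lcoord c p) (lcoord c @` dom c).
  by apply: open_nbhs_nbhs; split; [exact: open_codom|exists p].
by apply: filterS => _ [q cq <-]; rewrite lcoordK.
Qed.

Lemma near_in A p : open_in c A -> A p -> \forall q \near p, A q.
Proof. by move=> [oA _] Ap; apply: open_nbhs_nbhs. Qed.

Lemma pd_near F G i p : dom c p ->
  (\forall q \near p, F q = G q) -> pd c i F p = pd c i G p.
Proof. by move=> cp FG; apply: near_eq_derive; apply: near_param cp FG. Qed.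

Lemma pdiff_near F G p : dom c p ->
  (\forall q \near p, F q = G q) -> pdiff c F p -> pdiff c G p.
Proof.
by move=> cp FG; apply: differentiable_near_eq; apply: near_param cp FG.
Qed.

Lemma pd_eq A F G i p : open_in c A -> A p ->
  (forall q, A q -> F q = G q) -> pd c i F p = pd c i G p.
Proof.
move=> cA Ap FG; apply: pd_near; first exact: cA.2.
by apply: filterS (near_in cA Ap).
Qed.

Lemma pdiff_eq A F G p : open_in c A -> A p ->
  (forall q, A q -> F q = G q) -> pdiff c F p -> pdiff c G p.
Proof.
move=> cA Ap FG; apply: pdiff_near; first exact: cA.2.
by apply: filterS (near_in cA Ap).
Qed.

Lemma pdiff_cst (a : R) p : pdiff c (fun=> a) p.
Proof. exact: differentiable_cst. Qed.

Lemma pd_cst (a : R) i p : pd c i (fun=> a) p = 0.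
Proof. exact: derive_cst. Qed.

Lemma pdiffD F G p : pdiff c F p -> pdiff c G p -> pdiff c (fun q => F q + G q)
  p.
Proof. by move=> dF dG; apply: differentiableD. Qed.

Lemma pdD F G i p : pdiff c F p -> pdiff c G p ->
  pd c i (fun q => F q + G q) p = pd c i F p + pd c i G p.
Proof. by move=> dF dG; apply: deriveD; apply: diff_derivable. Qed.

Lemma pdN F i p : pdiff c F p -> pd c i (fun q => - F q) p = - pd c i F p.
Proof. by move=> dF; apply: deriveN; apply: diff_derivable. Qed.

Lemma pdiffM F G p : pdiff c F p -> pdiff c G p -> pdiff c (fun q => F q * G q)
  p.
Proof. by move=> dF dG; apply: differentiableM. Qed.

Lemma pdM F G i p : dom c p -> pdiff c F p -> pdiff c G p ->
  pd c i (fun q => F q * G q) p = pd c i F p * G p + F p * pd c i G p.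
Proof.
move=> cp dF dG; rewrite {1}/pd.
have -> : (fun q => F q * G q) \o param c = (F \o param c) * (G \o param c) by
  [].
rewrite deriveM; [|exact: diff_derivable..].
by rewrite /= lcoordK // addrC [G p *: _]mulrC.
Qed.

Lemma pdiffV F p : dom c p -> F p != 0 -> pdiff c F p ->
  pdiff c (fun q => (F q)^-1) p.
Proof. by move=> cp F0 dF; apply: differentiableV; rewrite //= lcoordK. Qed.

Lemma pdV F i p : dom c p -> F p != 0 -> pdiff c F p ->
  pd c i (fun q => (F q)^-1) p = - (F p)^-1 * (F p)^-1 * pd c i F p.
Proof.
move=> cp F0 dF; rewrite {1}/pd.
have -> : (fun q => (F q)^-1) \o param c = (fun x => ((F \o param c) x)^-1) by
  [].
rewrite deriveV /=; [|by rewrite lcoordK|exact: diff_derivable].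
by rewrite lcoordK // expr2 invfM mulNr.
Qed.

Lemma pdiff_sum (I : Type) (r : seq I) (P : pred I) (F : I -> X -> R) p :
  (forall k, P k -> pdiff c (F k) p) ->
  pdiff c (fun q => \sum_(k <- r | P k) F k q) p.
Proof.
move=> dF; elim: r => [|k r IH].
  by under eq_fun do rewrite big_nil; exact: pdiff_cst.
under eq_fun do rewrite big_cons.
have [Pk|//] := boolP (P k).
by apply: pdiffD => //; apply: dF.
Qed.

Lemma pd_sum (I : Type) (r : seq I) (P : pred I) (F : I -> X -> R) i p :
  (forall k, P k -> pdiff c (F k) p) ->
  pd c i (fun q => \sum_(k <- r | P k) F k q) p =
  \sum_(k <- r | P k) pd c i (F k) p.
Proof.
move=> dF; elim: r => [|k r IH].
  by under eq_fun do rewrite big_nil; rewrite pd_cst big_nil.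
under eq_fun do rewrite big_cons.
rewrite big_cons; have [Pk|//] := boolP (P k).
by rewrite pdD ?IH //; [exact: dF|exact: pdiff_sum].
Qed.

End chart.

Section chain.
Variables (R : realType) (n m : nat) (X : charted_space R n).
Variables (Y : charted_space R m) (f : X -> Y) (c : chart X) (d : chart Y).
Variable p : X.
Hypotheses (fc : {for p, continuous f}) (cp : dom c p) (dp : dom d (f p)).
Hypothesis df : forall k, pdiff c (fun q => lcoord d (f q) 0 k) p.
Variable H : Y -> R.
Hypothesis dH : pdiff d H (f p).

Let near_local : \forall x \near lcoord c p,
  (H \o param d \o (fun x => lcoord d (f (param c x)))) x
  = (H \o f \o param c) x.
Proof.
have : \forall q \near p, dom d (f q).
  by apply: fc; apply: open_nbhs_nbhs; split => //; exact: open_dom.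
by move=> /(near_param cp); apply: filterS => x /= dx; rewrite lcoordK.
Qed.

(** Near p, the expression of H o f in the chart c is that of H in the chart d,
    composed with the coordinate expression of f. *)
Lemma pdiff_comp : pdiff c (H \o f) p.
Proof.
apply: differentiable_near_eq near_local _.
apply: differentiable_comp; last by rewrite lcoordK.
exact: differentiable_rV.
Qed.

Lemma pd_comp i : pd c i (H \o f) p = \sum_k dmap f c d p i k * pd d k H (f p).
Proof.
have E : {near lcoord c p, (H \o f \o param c) =1
  (H \o param d \o (fun x => lcoord d (f (param c x))))}.
  by apply: filterS near_local => x ->.
rewrite /pd (near_eq_derive _ E) derive_comp_rV //; last by rewrite lcoordK.
by apply: eq_bigr => k _; rewrite mxE /= lcoordK.
Qed.

End chain.

(** * Smooth functions *)

Section smooth.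
Variables (R : realType) (n : nat) (X : charted_space R n) (c : chart X).
Implicit Types (F G : X -> R) (p q : X) (A B : set X).

Lemma smooth_on_pdiff A F p : smooth_on c A F -> A p -> pdiff c F p.
Proof. by move=> sF; apply: (sF [::]). Qed.

Lemma smooth_on_pd A F i : smooth_on c A F -> smooth_on c A (pd c i F).
Proof. by move=> sF s p /(sF (rcons s i)); rewrite foldr_rcons. Qed.

Lemma smooth_onW A B F : B `<=` A -> smooth_on c A F -> smooth_on c B F.
Proof. by move=> BA sF s p /BA; apply: sF. Qed.

Lemma smooth_on_near A F : (forall p, A p -> exists2 B, B p & smooth_on c B F)
  ->
  smooth_on c A F.
Proof. by move=> sF s p /sF[B Bp]; apply. Qed.

(** Smoothness by coinduction: a class of differentiable functions whose
    partial derivatives stay in the class consists of smooth functions. *)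
Lemma smooth_coind A (P : (X -> R) -> Prop) : open_in c A ->
  (forall F, P F -> (forall p, A p -> pdiff c F p) /\
     (forall i, exists2 G, P G & forall q, A q -> pd c i F q = G q)) ->
  forall F G, P G -> (forall q, A q -> F q = G q) -> smooth_on c A F.
Proof.
move=> cA HP F G PG FG s p Ap.
have [{PG FG}G PG FG] : exists2 G, P G & forall q, A q -> foldr (pd c) F s q =
  G q.
  elim: s => [|i s [G' PG' FG']] /=; first by exists G.
  have [_ /(_ i)[G'' PG'' FG'']] := HP _ PG'.
  exists G'' => // q Aq; rewrite -FG'' //.
  exact: pd_eq cA Aq FG'.
have [/(_ p Ap) dG _] := HP _ PG.
by apply: pdiff_eq cA Ap _ dG => q Aq; rewrite FG.
Qed.

Lemma smooth_on_eq A F G : open_in c A -> (forall q, A q -> F q = G q) ->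
  smooth_on c A G -> smooth_on c A F.
Proof.
move=> cA FG sG; apply: (@smooth_coind _ (smooth_on c A) cA _ _ G) => // H sH.
split=> [p|i]; first exact: smooth_on_pdiff.
by exists (pd c i H); first exact: smooth_on_pd.
Qed.

End smooth.

Section smooth_closure.
Variables (R : realType) (n : nat) (X : charted_space R n) (c : chart X).
Implicit Types (F G : X -> R) (p q : X) (A B : set X).

(** The expressions built from smooth functions are stable under partial
    derivatives, by the Leibniz, quotient and chain rules. *)
Inductive smooth_expr A : (X -> R) -> Prop :=
| SmoothBase F of smooth_on c A F : smooth_expr A F
| SmoothCst (a : R) : smooth_expr A (fun=> a)
| SmoothAdd F G of smooth_expr A F & smooth_expr A G :
    smooth_expr A (fun q => F q + G q)
| SmoothMul F G of smooth_expr A F & smooth_expr A G :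
    smooth_expr A (fun q => F q * G q)
| SmoothInv F of smooth_expr A F & (forall q, A q -> F q != 0) :
    smooth_expr A (fun q => (F q)^-1)
| SmoothComp m (Y : charted_space R m) (f : X -> Y) (d : chart Y)
    (B : set Y) (H : Y -> R) of
    (forall q, A q -> {for q, continuous f}) & (forall q, A q -> B (f q)) &
    open_in d B & (forall k, smooth_on c A (fun q => lcoord d (f q) 0 k)) &
    smooth_on d B H : smooth_expr A (H \o f).

Lemma smooth_exprP A F : open_in c A -> smooth_expr A F -> smooth_on c A F.
Proof.
move=> cA sF; apply: (@smooth_coind _ _ _ _ _ (smooth_expr A) cA _ F F) => //
  {sF}.
have Ac q : A q -> dom c q by exact: cA.2.
move=> {}F; elim=> {F}.
- move=> F sF; split=> [p|i]; first exact: smooth_on_pdiff.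
  by exists (pd c i F) => //; apply: SmoothBase; exact: smooth_on_pd.
- move=> a; split=> [p _|i]; first exact: pdiff_cst.
  by exists (fun=> 0); [exact: SmoothCst|move=> q _; rewrite pd_cst].
- move=> F G eF [dF pF] eG [dG pG]; split=> [p Ap|i].
    by apply: pdiffD; [exact: dF|exact: dG].
  have [F' eF' pF'] := pF i; have [G' eG' pG'] := pG i.
  exists (fun q => F' q + G' q); first exact: SmoothAdd.
  by move=> q Aq; rewrite pdD ?pF' ?pG' //; [exact: dF|exact: dG].
- move=> F G eF [dF pF] eG [dG pG]; split=> [p Ap|i].
    by apply: pdiffM; [exact: dF|exact: dG].
  have [F' eF' pF'] := pF i; have [G' eG' pG'] := pG i.
  exists (fun q => F' q * G q + F q * G' q).
    by apply: SmoothAdd; exact: SmoothMul.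
  move=> q Aq; rewrite pdM ?pF' ?pG' //; [exact: Ac|exact: dF|exact: dG].
- move=> F eF [dF pF] F0; split=> [p Ap|i].
    by apply: pdiffV; [exact: Ac|exact: F0|exact: dF].
  have [F' eF' pF'] := pF i.
  exists (fun q => (-1) * (F q)^-1 * (F q)^-1 * F' q).
    have eV : smooth_expr A (fun q => (F q)^-1) by apply: SmoothInv.
    by do 3?apply: SmoothMul => //; apply: SmoothCst.
  by move=> q Aq; rewrite pdV ?pF' ?mulN1r //; [exact: Ac|exact: F0|exact: dF].
- move=> m Y f d B H fc AB dB sf sH; split=> [p Ap|i].
    apply: (pdiff_comp (fc _ Ap) (Ac _ Ap) (dB.2 _ (AB _ Ap))).
      by move=> k; exact: smooth_on_pdiff (sf k) Ap.
    by apply: smooth_on_pdiff sH (AB _ Ap).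
  exists (fun q => \sum_k dmap f c d q i k * pd d k H (f q)); last first.
    move=> q Aq; apply: (pd_comp (fc _ Aq) (Ac _ Aq) (dB.2 _ (AB _ Aq))).
      by move=> k; exact: smooth_on_pdiff (sf k) Aq.
    by apply: smooth_on_pdiff sH (AB _ Aq).
  elim: index_enum => [|k r IH].
    by under eq_fun do rewrite big_nil; exact: SmoothCst.
  under eq_fun do rewrite big_cons.
  apply: SmoothAdd => //; apply: SmoothMul.
    under eq_fun do rewrite mxE.
    by apply: SmoothBase; apply: smooth_on_pd.
  apply: (@SmoothComp A m Y f d B (pd d k H)) => //.
  exact: smooth_on_pd.
Qed.

Section closure.
Variable A : set X.
Hypothesis cA : open_in c A.

Lemma smooth_on_cst (a : R) : smooth_on c A (fun=> a).
Proof. by apply: smooth_exprP => //; apply: SmoothCst. Qed.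

Lemma smooth_onD F G : smooth_on c A F -> smooth_on c A G ->
  smooth_on c A (fun q => F q + G q).
Proof.
by move=> sF sG; apply: smooth_exprP => //; apply: SmoothAdd; apply: SmoothBase.
Qed.

Lemma smooth_onM F G : smooth_on c A F -> smooth_on c A G ->
  smooth_on c A (fun q => F q * G q).
Proof.
by move=> sF sG; apply: smooth_exprP => //; apply: SmoothMul; apply: SmoothBase.
Qed.

Lemma smooth_onN F : smooth_on c A F -> smooth_on c A (fun q => - F q).
Proof.
move=> sF; under eq_fun do rewrite -mulN1r.
by apply: smooth_onM => //; exact: smooth_on_cst.
Qed.

Lemma smooth_onV F : smooth_on c A F -> (forall q, A q -> F q != 0) ->
  smooth_on c A (fun q => (F q)^-1).
Proof.
by move=> sF F0; apply: smooth_exprP => //; apply: SmoothInv => //; apply: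
  SmoothBase.
Qed.

Lemma smooth_on_sum (I : Type) (r : seq I) (P : pred I) (F : I -> X -> R) :
  (forall k, P k -> smooth_on c A (F k)) ->
  smooth_on c A (fun q => \sum_(k <- r | P k) F k q).
Proof.
move=> sF; elim: r => [|k r IH].
  by under eq_fun do rewrite big_nil; exact: smooth_on_cst.
under eq_fun do rewrite big_cons; have [Pk|//] := boolP (P k).
by apply: smooth_onD => //; exact: sF.
Qed.

Lemma smooth_on_prod (I : Type) (r : seq I) (P : pred I) (F : I -> X -> R) :
  (forall k, P k -> smooth_on c A (F k)) ->
  smooth_on c A (fun q => \prod_(k <- r | P k) F k q).
Proof.
move=> sF; elim: r => [|k r IH].
  by under eq_fun do rewrite big_nil; exact: smooth_on_cst.
under eq_fun do rewrite big_cons; have [Pk|//] := boolP (P k).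
by apply: smooth_onM => //; exact: sF.
Qed.

Lemma smooth_on_comp m (Y : charted_space R m) (f : X -> Y) d (B : set Y) H :
  (forall q, A q -> {for q, continuous f}) -> (forall q, A q -> B (f q)) ->
  open_in d B -> (forall k, smooth_on c A (fun q => lcoord d (f q) 0 k)) ->
  smooth_on d B H -> smooth_on c A (H \o f).
Proof.
by move=> fc AB dB sf sH; apply: smooth_exprP => //; exact: (@SmoothComp _ m Y
  f d B).
Qed.

(** In the chart this is the symmetry of second derivatives, since smooth
    functions have differentiable first derivatives. *)
Lemma pd_comm F i j p : smooth_on c A F -> A p ->
  pd c i (pd c j F) p = pd c j (pd c i F) p.
Proof.
move=> sF Ap; have cp : dom c p by exact: cA.2.
have E k : \forall x \near lcoord c p,
    (pd c k F \o param c) x = 'D_(delta_mx 0 k) (F \o param c) x.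
  by apply: filterS (near_codom cp) => x [_ xK]; rewrite /= /pd xK.
have dk k : differentiable ('D_(delta_mx 0 k) (F \o param c)) (lcoord c p).
  by apply: differentiable_near_eq (E k) _; exact: (sF [:: k]).
rewrite /pd (near_eq_derive _ (E j)) (near_eq_derive _ (E i)).
apply: derive_comm => //.
apply: filterS2 (near_param cp (near_in cA Ap)) (near_codom cp) => x Ax [_ xK].
by have := sF [::] _ Ax; rewrite /= xK.
Qed.

End closure.
End smooth_closure.

(** * Matrix-valued functions *)

Section entries.
Variables (R : pzRingType) (a b : nat).
Implicit Types (V W : 'M[R]_(a, b)).

Lemma addmxE V W i j : (V + W) i j = V i j + W i j.
Proof. by rewrite mxE. Qed.

Lemma oppmxE V i j : (- V) i j = - V i j.
Proof. by rewrite mxE. Qed.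

Lemma scalemxE x V i j : (x *: V) i j = x * V i j.
Proof. by rewrite mxE. Qed.

Lemma zeromxE i j : (0 : 'M[R]_(a, b)) i j = 0.
Proof. by rewrite mxE. Qed.

Lemma tr_addmx V W : (V + W)^T = V^T + W^T.
Proof. exact: linearD. Qed.

Lemma tr_oppmx V : (- V)^T = - V^T.
Proof. exact: linearN. Qed.

Lemma row_addmx V W i : row i (V + W) = row i V + row i W.
Proof. exact: linearD. Qed.

Lemma row_oppmx V i : row i (- V) = - row i V.
Proof. exact: linearN. Qed.

End entries.

(** Entrywise partial derivative. It is locked because deciding whether two
    partial derivatives are convertible would unfold them down to limits. *)
HB.lock Definition pd_mx (R : realType) (n : nat) (X : charted_space R n)
    (c : chart X) (i : 'I_n) (a b : nat) (W : X -> 'M[R]_(a, b))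
    (p : X) : 'M[R]_(a, b) :=
  \matrix_(j, k) pd c i (fun q => W q j k) p.

Definition smooth_mx (R : realType) (n : nat) (X : charted_space R n)
    (c : chart X) (A : set X) (a b : nat) (W : X -> 'M[R]_(a, b)) : Prop :=
  forall j k, smooth_on c A (fun q => W q j k).

Lemma pd_mxE (R : realType) (n : nat) (X : charted_space R n) (c : chart X)
    (i : 'I_n) (a b : nat) (W : X -> 'M[R]_(a, b)) p j k :
  pd_mx c i W p j k = pd c i (fun q => W q j k) p.
Proof. by rewrite pd_mx.unlock mxE. Qed.

Lemma dmapE (R : realType) (n m : nat) (X : charted_space R n)
    (Y : charted_space R m) (f : X -> Y) (c : chart X) (d : chart Y) p i k :
  dmap f c d p i k = pd c i (fun q => lcoord d (f q) 0 k) p.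
Proof. by rewrite mxE. Qed.

Section matrix_calculus.
Variables (R : realType) (n : nat) (X : charted_space R n) (c : chart X).
Variable A : set X.
Hypothesis cA : open_in c A.
Implicit Types (F G : X -> R) (p q : X).

Lemma smooth_mx_eq a b (V W : X -> 'M[R]_(a, b)) :
  (forall q, A q -> V q = W q) -> smooth_mx c A W -> smooth_mx c A V.
Proof.
move=> VW sW j k; apply: smooth_on_eq (sW j k) => // q Aq.
by rewrite VW.
Qed.

Lemma smooth_mxD a b (V W : X -> 'M[R]_(a, b)) :
  smooth_mx c A V -> smooth_mx c A W -> smooth_mx c A (fun q => V q + W q).
Proof.
by move=> sV sW j k; under eq_fun do rewrite mxE; apply: smooth_onD.
Qed.

Lemma smooth_mxN a b (W : X -> 'M[R]_(a, b)) :
  smooth_mx c A W -> smooth_mx c A (fun q => - W q).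
Proof. by move=> sW j k; under eq_fun do rewrite mxE; apply: smooth_onN. Qed.

Lemma smooth_mxB a b (V W : X -> 'M[R]_(a, b)) :
  smooth_mx c A V -> smooth_mx c A W -> smooth_mx c A (fun q => V q - W q).
Proof. by move=> sV sW; apply: smooth_mxD => //; apply: smooth_mxN. Qed.

Lemma smooth_mxT a b (W : X -> 'M[R]_(a, b)) :
  smooth_mx c A W -> smooth_mx c A (fun q => (W q)^T).
Proof. by move=> sW j k; under eq_fun do rewrite mxE; apply: sW. Qed.

Lemma smooth_mxM a b e (V : X -> 'M[R]_(a, b)) (W : X -> 'M[R]_(b, e)) :
  smooth_mx c A V -> smooth_mx c A W -> smooth_mx c A (fun q => V q *m W q).
Proof.
move=> sV sW j k; under eq_fun do rewrite mxE.
by apply: smooth_on_sum => // l _; apply: smooth_onM.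
Qed.

Lemma smooth_mxZ a b F (W : X -> 'M[R]_(a, b)) :
  smooth_on c A F -> smooth_mx c A W -> smooth_mx c A (fun q => F q *: W q).
Proof. by move=> sF sW j k; under eq_fun do rewrite mxE; apply: smooth_onM. Qed.

Lemma smooth_mx_sum a b (I : finType) (W : I -> X -> 'M[R]_(a, b)) :
  (forall l, smooth_mx c A (W l)) -> smooth_mx c A (fun q => \sum_l W l q).
Proof.
move=> sW j k; under eq_fun do rewrite summxE.
by apply: smooth_on_sum => // l _; apply: sW.
Qed.

Lemma smooth_on_det a (W : X -> 'M[R]_a) :
  smooth_mx c A W -> smooth_on c A (fun q => \det (W q)).
Proof.
move=> sW; apply: smooth_on_sum => // s _; apply: smooth_onM => //.
  exact: smooth_on_cst.
by apply: smooth_on_prod => // l _; apply: sW.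
Qed.

Lemma smooth_invmx a (W : X -> 'M[R]_a) :
  (forall q, A q -> W q \in unitmx) ->
  smooth_mx c A W -> smooth_mx c A (fun q => invmx (W q)).
Proof.
move=> uW sW; apply: (@smooth_mx_eq _ _ _ (fun q => (\det (W q))^-1 *: \adj (W
  q))).
  by move=> q Aq; rewrite /invmx uW.
apply: smooth_mxZ.
  apply: smooth_onV => // [|q Aq]; first exact: smooth_on_det.
  by have := uW q Aq; rewrite unitmxE unitfE.
move=> j k; under eq_fun do rewrite mxE; apply: smooth_onM => //.
  exact: smooth_on_cst.
apply: smooth_on_det => j' k'; under eq_fun do rewrite !mxE; exact: sW.
Qed.

Lemma smooth_pd_mx a b (W : X -> 'M[R]_(a, b)) i :
  smooth_mx c A W -> smooth_mx c A (pd_mx c i W).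
Proof.
by move=> sW j k; under eq_fun do rewrite pd_mxE; apply: smooth_on_pd.
Qed.

Variable p : X.
Hypothesis Ap : A p.

Let diff_mx a b (W : X -> 'M[R]_(a, b)) j k :
  smooth_mx c A W -> pdiff c (fun q => W q j k) p.
Proof. by move=> sW; exact: smooth_on_pdiff (sW j k) Ap. Qed.

Lemma pd_mx_eq a b (V W : X -> 'M[R]_(a, b)) i :
  (forall q, A q -> V q = W q) -> pd_mx c i V p = pd_mx c i W p.
Proof.
by move=> VW; apply/matrixP => j k; rewrite !pd_mxE; apply: pd_eq cA Ap _ => q
  /VW ->.
Qed.

Lemma pd_mx_cst a b (W : 'M[R]_(a, b)) i : pd_mx c i (fun=> W) p = 0.
Proof. by apply/matrixP => j k; rewrite pd_mxE pd_cst mxE. Qed.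

Lemma pd_mxD a b (V W : X -> 'M[R]_(a, b)) i :
  smooth_mx c A V -> smooth_mx c A W ->
  pd_mx c i (fun q => V q + W q) p = pd_mx c i V p + pd_mx c i W p.
Proof.
move=> sV sW; apply/matrixP => j k; rewrite !(mxE, pd_mxE).
by under eq_fun do rewrite mxE; rewrite pdD //; apply: diff_mx.
Qed.

Lemma pd_mxN a b (W : X -> 'M[R]_(a, b)) i :
  smooth_mx c A W -> pd_mx c i (fun q => - W q) p = - pd_mx c i W p.
Proof.
move=> sW; apply/matrixP => j k; rewrite !(mxE, pd_mxE).
by under eq_fun do rewrite mxE; rewrite pdN //; apply: diff_mx.
Qed.

Lemma pd_mxB a b (V W : X -> 'M[R]_(a, b)) i :
  smooth_mx c A V -> smooth_mx c A W ->
  pd_mx c i (fun q => V q - W q) p = pd_mx c i V p - pd_mx c i W p.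
Proof. by move=> sV sW; rewrite pd_mxD ?pd_mxN //; apply: smooth_mxN. Qed.

Lemma pd_mxT a b (W : X -> 'M[R]_(a, b)) i :
  pd_mx c i (fun q => (W q)^T) p = (pd_mx c i W p)^T.
Proof.
by apply/matrixP => j k; rewrite !(mxE, pd_mxE); under eq_fun do rewrite mxE.
Qed.

Lemma pd_mx_row a b (W : X -> 'M[R]_(a, b)) i l :
  pd_mx c i (fun q => row l (W q)) p = row l (pd_mx c i W p).
Proof.
by apply/matrixP => j k; rewrite !(mxE, pd_mxE); under eq_fun do rewrite mxE.
Qed.

Lemma pd_mxM a b e (V : X -> 'M[R]_(a, b)) (W : X -> 'M[R]_(b, e)) i :
  smooth_mx c A V -> smooth_mx c A W ->
  pd_mx c i (fun q => V q *m W q) p = pd_mx c i V p *m W p + V p *m pd_mx c i W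
    p.
Proof.
move=> sV sW; apply/matrixP => j k; rewrite !(mxE, pd_mxE).
under eq_fun do rewrite mxE; rewrite pd_sum => [|l _]; last first.
  by apply: pdiffM; apply: diff_mx.
rewrite -big_split; apply: eq_bigr => l _ /=; rewrite !pd_mxE pdM //; last 2
  first.
- exact: diff_mx.
- exact: diff_mx.
exact: cA.2.
Qed.

Lemma pd_mxZ a b F (W : X -> 'M[R]_(a, b)) i :
  smooth_on c A F -> smooth_mx c A W ->
  pd_mx c i (fun q => F q *: W q) p = pd c i F p *: W p + F p *: pd_mx c i W p.
Proof.
move=> sF sW; apply/matrixP => j k; rewrite !(mxE, pd_mxE).
under eq_fun do rewrite mxE; rewrite pdM //; first exact: cA.2.
  exact: smooth_on_pdiff sF Ap.
exact: diff_mx.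
Qed.

Lemma pd_mx_sum a b (I : finType) (W : I -> X -> 'M[R]_(a, b)) i :
  (forall l, smooth_mx c A (W l)) ->
  pd_mx c i (fun q => \sum_l W l q) p = \sum_l pd_mx c i (W l) p.
Proof.
move=> sW; apply/matrixP => j k; rewrite summxE !(mxE, pd_mxE).
under eq_fun do rewrite summxE; rewrite pd_sum => [|l _]; last exact: diff_mx.
by apply: eq_bigr => l _; rewrite pd_mxE.
Qed.

Lemma pd_mx_comm a b (W : X -> 'M[R]_(a, b)) i j : smooth_mx c A W ->
  pd_mx c i (pd_mx c j W) p = pd_mx c j (pd_mx c i W) p.
Proof.
move=> sW.
apply/matrixP => k l.
rewrite !pd_mxE.
have E e : (fun q => pd_mx c e W q k l) = pd c e (fun q => W q k l).
  by apply/funext => q; rewrite pd_mxE.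
by rewrite !E (pd_comm cA).
Qed.

End matrix_calculus.

Section matrix_chain.
Variables (R : realType) (n m : nat) (X : charted_space R n).
Variables (Y : charted_space R m) (f : X -> Y) (c : chart X) (d : chart Y).
Variables (A : set X) (B : set Y).
Hypotheses (cA : open_in c A) (dB : open_in d B).
Hypotheses (fc : forall q, A q -> {for q, continuous f}).
Hypotheses (fA : forall q, A q -> B (f q)).
Hypothesis sf : forall k, smooth_on c A (fun q => lcoord d (f q) 0 k).

Lemma smooth_mx_comp a b (W : Y -> 'M[R]_(a, b)) :
  smooth_mx d B W -> smooth_mx c A (fun q => W (f q)).
Proof. by move=> sW j k; apply: (smooth_on_comp cA fc fA dB sf (sW j k)). Qed.

Lemma smooth_dmap : smooth_mx c A (dmap f c d).
Proof.
by move=> j k; under eq_fun do rewrite mxE; apply: smooth_on_pd.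
Qed.

Lemma pd_mx_comp a b (W : Y -> 'M[R]_(a, b)) i p : A p -> smooth_mx d B W ->
  pd_mx c i (fun q => W (f q)) p = \sum_k dmap f c d p i k *: pd_mx d k W (f p).
Proof.
move=> Ap sW; apply/matrixP => j k; rewrite summxE pd_mxE.
rewrite (@pd_comp _ _ _ _ _ f c d p _ _ _ _ (fun q => W q j k)) //.
- by apply: eq_bigr => l _; rewrite scalemxE pd_mxE.
- exact: fc.
- exact: cA.2.
- by apply: dB.2; exact: fA.
- by move=> l; exact: smooth_on_pdiff (sf l) Ap.
- by exact: smooth_on_pdiff (sW j k) (fA Ap).
Qed.

(** The coordinate expression of f has symmetric second derivatives; this is
    what makes the second fundamental form symmetric. *)
Lemma dmap_comm i j p : A p ->
  row j (pd_mx c i (dmap f c d) p) = row i (pd_mx c j (dmap f c d) p).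
Proof.
move=> Ap; apply/rowP => k; rewrite [LHS]mxE [RHS]mxE !pd_mxE.
have E e : (fun q => dmap f c d q e k) = pd c e (fun q => lcoord d (f q) 0 k).
  by apply/funext => q; rewrite dmapE.
by rewrite !E (pd_comm cA).
Qed.

End matrix_chain.

(** Proves linear identities between matrices, with products as atoms. *)
Ltac mx_lin :=
  apply/matrixP => ? ?; rewrite !(addmxE, oppmxE, scalemxE, zeromxE); ring.

(** * Orthonormal frames *)

Section frames.
Variable (R : realType).

(** Gram-Schmidt, by induction on the dimension: after orthogonalizing the
    other coordinates against the first one, the form is given by the Schur
    complement, which is again positive definite. *)
Lemma posdef_orthonormal n (G : 'M[R]_n) : G^T = G ->
  (forall v : 'rV[R]_n, v != 0 -> 0 < (v *m G *m v^T) 0 0) ->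
  exists E : 'M[R]_n, E *m G *m E^T = 1%:M.
Proof.
elim: n G => [|n IH] G GT Gpos; first by exists 0; apply/matrixP => -[].
move: G GT Gpos; rewrite -[n.+1]/(1 + n)%N => G; rewrite -[G]submxK.
set a := ulsubmx _; set b := ursubmx _; set b' := dlsubmx _; set S := drsubmx _.
clearbody a b b' S => {G}.
rewrite tr_block_mx => /eq_block_mx[_ _ bT ST] Gpos.
rewrite [a]mx11_scalar in Gpos *; set al := a 0 0 in Gpos *; clearbody al =>
  {a}.
have al0 : 0 < al.
  have := Gpos (row_mx 1%:M 0 : 'rV[R]_(1 + n)).
  rewrite mul_row_block tr_row_mx mul_row_col trmx0 !mul0mx mulmx0.
  rewrite !addr0 trmx1 mulmx1 mul1mx [X in _ < X]mxE; apply.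
  apply/eqP => /(congr1 (@lsubmx R 1 1 n)); rewrite row_mxKl linear0.
  by move/matrixP => /(_ 0 0); rewrite !mxE /=; exact/eqP/oner_neq0.
pose S' := S - al^-1 *: (b' *m b).
have [||E' HE'] := IH S'.
- rewrite /S' tr_addmx tr_oppmx [(al^-1 *: _)^T]linearZ /= trmx_mul ST; congr
  (_ - _ *: (_ *m _)) => //.
  by rewrite -bT trmxK.
  (* the lift of v that is orthogonal to the first basis vector *)
- move=> v v0; pose w : 'rV[R]_(1 + n) := row_mx (- al^-1 *: (v *m b')) v.
  have := Gpos w; rewrite mul_row_block tr_row_mx mul_row_col.
  have -> : - al^-1 *: (v *m b') *m al%:M + v *m b' = 0.
    rewrite mul_mx_scalar scalerA mulrN mulfV ?gt_eqF //.
    by rewrite scaleN1r addNr.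
  rewrite mul0mx add0r scaleNr mulNmx -scalemxAl [in X in X -> _]addrC.
  rewrite -[v *m b' *m b]mulmxA scalemxAr -mulmxBr; apply.
  apply/eqP => /(congr1 (@rsubmx R 1 1 n)); rewrite row_mxKr linear0.
  exact/eqP.
pose r := Num.sqrt al.
have r0 : r != 0 by rewrite gt_eqF // sqrtr_gt0.
have rr : al = r * r by rewrite -expr2 sqr_sqrtr // ltW.
exists (block_mx r^-1%:M 0 (- al^-1 *: (E' *m b')) E').
rewrite tr_block_mx !mulmx_block !mul0mx !addr0 [RHS]scalar_mx_block.
rewrite trmx0 mulmx0 !addr0.
have -> : - al^-1 *: (E' *m b') *m al%:M + E' *m b' = 0.
  rewrite mul_mx_scalar scalerA mulrN mulfV ?gt_eqF //.
  by rewrite scaleN1r addNr.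
rewrite !mul0mx !add0r; congr block_mx.
- rewrite tr_scalar_mx -!scalar_mxM rr; congr (_%:M); by field.
- rewrite !linearZ /= trmx_mul -bT trmxK -scalar_mxM.
  rewrite !mul_scalar_mx -scalemxAl scalerA -scalerDl rr.
  rewrite (_ : _ + _ = 0) ?scale0r //; by field.
- by rewrite mulmx0.
- rewrite -HE' /S' mulmxBr scaleNr mulNmx -scalemxAl -mulmxA addrC.
  by rewrite -scalemxAr.
Qed.

Lemma orthonormal_unit n (E G : 'M[R]_n) : E *m G *m E^T = 1%:M -> G \in unitmx.
Proof.
move=> H; have /mulmx1_unit[] : E *m G *m E^T = 1%:M by [].
by rewrite unitmx_mul => /andP[].
Qed.

(** The Gram matrix of the rows of an orthonormal basis is the inverse metric,
    hence independent of the basis. *)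
Lemma orthonormal_inv n (E G : 'M[R]_n) : E *m G *m E^T = 1%:M ->
  E^T *m E = invmx G.
Proof.
move=> H; have Gu := orthonormal_unit H.
apply: (can_inj (mulKmx Gu)); rewrite mulmxV // mulmxA.
by apply: mulmx1C; rewrite mulmxA.
Qed.

(** The equality of dimensions is propositional, as it will be n + n = 2 n. *)
Lemma orthonormal_inv_rect k m (T : 'M[R]_(k, m)) (G : 'M[R]_m) : k = m ->
  T *m G *m T^T = 1%:M -> T^T *m T = invmx G.
Proof. by move=> e; case: _ / e G T => G T; apply: orthonormal_inv. Qed.

(** The sum of a bilinear form over a family of vectors only depends on the Gram
    matrix of the family, which for orthonormal bases is the inverse metric. *)
Lemma sum_row_form k m (T : 'M[R]_(k, m)) (Q : 'M[R]_m) :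
  \sum_i (row i T *m Q *m (row i T)^T) 0 0 = \tr (Q *m (T^T *m T)).
Proof.
rewrite mulmxA mxtrace_mulC mulmxA; apply: eq_bigr => i _.
rewrite -row_mul !mxE; apply: eq_bigr => j _; by rewrite !mxE.
Qed.

End frames.

(** * The Levi-Civita connection and its curvature *)

(** Row j holds the components of nabla_{d_i} d_j. As vectors are rows,
    nabla_{d_i} w = d_i w + w *m chris_mx i: these are connection matrices. *)
HB.lock Definition chris_mx (R : realType) (n : nat)
    (X : riemannian_manifold R n) (c : chart X) (i : 'I_n) (p : X) : 'M[R]_n :=
  \matrix_(j, k) christoffel c i j k p.

(** The endomorphism z |-> K(d_i, d_j) z, acting on rows from the right. *)
HB.lock Definition curv_mx (R : realType) (n : nat)
    (X : riemannian_manifold R n) (c : chart X) (i j : 'I_n) (p : X) : 'M[R]_n :=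
  \matrix_(k, l) curvature_coef c i j k l p.

(** The endomorphism z |-> K(x, y) z. *)
Definition curv_form (R : realType) (n : nat) (X : riemannian_manifold R n)
    (c : chart X) (p : X) (x y : 'rV[R]_n) : 'M[R]_n :=
  \sum_i \sum_j (x 0 i * y 0 j) *: curv_mx c i j p.

Section levi_civita.
Variables (R : realType) (n : nat) (X : riemannian_manifold R n) (c : chart X).
Implicit Types (p : X) (i j k l : 'I_n).

Let cX : open_in c (dom c) := open_in_dom c.

Lemma chris_mxE i j k p : chris_mx c i p j k = christoffel c i j k p.
Proof. by rewrite chris_mx.unlock mxE. Qed.

Lemma frameP p : dom c p -> frame c p *m metric c p *m (frame c p)^T = 1%:M.
Proof.
move=> cp; have [E HE] := posdef_orthonormal (Defs.metric_sym cp) (fun v =>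
  Defs.metric_pos cp).
by rewrite /frame; case: xgetP => [F _ //|/(_ E)].
Qed.

Lemma metric_unit p : dom c p -> metric c p \in unitmx.
Proof. by move=> cp; apply: orthonormal_unit (frameP cp). Qed.

Lemma smooth_metric : smooth_mx c (dom c) (metric c).
Proof. by move=> j k; exact: metric_smooth. Qed.

(** Twice the inner products of nabla_{d_i} d_j and d_l. *)
Definition koszul i p : 'M[R]_n :=
  \matrix_(j, l) (pd_mx c i (metric c) p j l + pd_mx c j (metric c) p i l
                  - pd_mx c l (metric c) p i j).

Lemma chris_mx_koszul i p :
  chris_mx c i p = 2^-1 *: (koszul i p *m invmx (metric c p)).
Proof.
apply/matrixP => j k; rewrite chris_mxE scalemxE mxE; congr (_ * _).
by apply: eq_bigr => l _; rewrite mxE !pd_mxE.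
Qed.

Lemma chris_mx_metric i p : dom c p ->
  chris_mx c i p *m metric c p = 2^-1 *: koszul i p.
Proof.
by move=> cp; rewrite chris_mx_koszul -scalemxAl mulmxKV // metric_unit.
Qed.

Lemma smooth_chris i : smooth_mx c (dom c) (chris_mx c i).
Proof.
apply: (smooth_mx_eq cX (fun q _ => chris_mx_koszul i q)).
apply: smooth_mxZ => //; first exact: smooth_on_cst.
apply: smooth_mxM => //; last first.
  by apply: smooth_invmx => // [q|]; [exact: metric_unit|exact: smooth_metric].
have sd k : smooth_mx c (dom c) (pd_mx c k (metric c)) := smooth_pd_mx k
  smooth_metric.
move=> j l; under eq_fun do rewrite mxE.
apply: smooth_onD => //; first by apply: smooth_onD => //; apply: sd.
by apply: smooth_onN => //; apply: sd.
Qed.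

Lemma pd_mx_metricT l p : dom c p -> (pd_mx c l (metric c) p)^T = pd_mx c l
  (metric c) p.
Proof.
by move=> cp; rewrite -pd_mxT; apply: (pd_mx_eq cX) => // q; exact:
  Defs.metric_sym.
Qed.

Lemma chris_sym i j p : dom c p -> row j (chris_mx c i p) = row i (chris_mx c j
  p).
Proof.
move=> cp; rewrite !chris_mx_koszul !linearZ /= !row_mul; congr (_ *: (_ *m _)).
apply/rowP => l; rewrite ![row _ _ _ _]mxE [LHS]mxE [RHS]mxE.
by rewrite -[in pd_mx c l _ _ j i](pd_mx_metricT l cp) [trmx _ _ _]mxE [X in X
  - _]addrC.
Qed.

(** Compatibility with the metric: add to the Koszul formula its transpose. *)
Lemma pd_mx_metric i p : dom c p -> pd_mx c i (metric c) p =
  chris_mx c i p *m metric c p + metric c p *m (chris_mx c i p)^T.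
Proof.
move=> cp; have -> : metric c p *m (chris_mx c i p)^T
    = (chris_mx c i p *m metric c p)^T by rewrite trmx_mul Defs.metric_sym.
rewrite chris_mx_metric //; apply/matrixP => j l.
have T k a b : pd_mx c k (metric c) p a b = pd_mx c k (metric c) p b a.
  by rewrite -[in LHS](pd_mx_metricT k cp) mxE.
rewrite addmxE [trmx _ _ _]mxE !scalemxE [koszul _ _ _ _]mxE [koszul _ _ l
  j]mxE.
rewrite (T i l j) (T j i l) (T l i j); lra.
Qed.

Lemma curv_mxE i j p : curv_mx c i j p =
  pd_mx c i (chris_mx c j) p - pd_mx c j (chris_mx c i) p
  + (chris_mx c j p *m chris_mx c i p - chris_mx c i p *m chris_mx c j p).
Proof.
rewrite curv_mx.unlock; apply/matrixP => k l; rewrite mxE /curvature_coef.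
rewrite !addmxE !oppmxE !pd_mxE; congr (pd c i _ p - pd c j _ p + _).
- by apply/funext => q; rewrite chris_mxE.
- by apply/funext => q; rewrite chris_mxE.
rewrite ![(_ *m _) _ _]mxE -sumrB; apply: eq_bigr => a _.
by rewrite !chris_mxE.
Qed.

Lemma curvatureE p x y z : curvature c p x y z = z *m curv_form c p x y.
Proof.
apply/rowP => l; rewrite !mxE.
under eq_bigr do rewrite exchange_big /=.
rewrite exchange_big; apply: eq_bigr => k _ /=.
rewrite summxE mulr_sumr; apply: eq_bigr => i _.
rewrite summxE mulr_sumr; apply: eq_bigr => j _.
by rewrite curv_mx.unlock scalemxE mxE; ring.
Qed.

Lemma curv_mx_anti i j p : curv_mx c j i p = - curv_mx c i j p.
Proof. by rewrite !curv_mxE; mx_lin. Qed.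

(** The second derivatives of the metric commute; express them through the
    compatibility of the connection with the metric. *)
Lemma curv_mx_metric i j p : dom c p ->
  curv_mx c i j p *m metric c p + metric c p *m (curv_mx c i j p)^T = 0.
Proof.
move=> cp; set g := metric c p.
have dd a b : pd_mx c a (pd_mx c b (metric c)) p =
    pd_mx c a (chris_mx c b) p *m g + chris_mx c b p *m pd_mx c a (metric c) p
    + (pd_mx c a (metric c) p *m (chris_mx c b p)^T
       + g *m (pd_mx c a (chris_mx c b) p)^T).
  rewrite (pd_mx_eq cX cp (V := pd_mx c b (metric c)) _ (fun q => @pd_mx_metric
    b q)).
  have sg := smooth_metric; have sG := smooth_chris b.
  have sGT := smooth_mxT sG.
  by rewrite (pd_mxD cp) ?(pd_mxM cX cp) ?pd_mxT //; exact: (smooth_mxM cX).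
have := pd_mx_comm cX cp i j smooth_metric; rewrite !dd !pd_mx_metric // -/g.
rewrite curv_mxE !(tr_addmx, tr_oppmx) !trmx_mul.
rewrite !(mulmxDl, mulmxDr, mulNmx, mulmxN) !mulmxA => /eqP.
rewrite -subr_eq0 => /eqP <-; mx_lin.
Qed.

(** The symmetry of the Christoffel symbols makes the terms cancel in pairs. *)
Lemma bianchi i j k p : dom c p ->
  row k (curv_mx c i j p) + row i (curv_mx c j k p) + row j (curv_mx c k i p)
  = 0.
Proof.
move=> cp; rewrite !curv_mxE !(row_addmx, row_oppmx) !row_mul.
rewrite (chris_sym j k cp) (chris_sym i k cp) (chris_sym i j cp).
have H a b e : row a (pd_mx c b (chris_mx c e) p) = row e (pd_mx c b (chris_mx
  c a) p).
  rewrite -!pd_mx_row; apply: (pd_mx_eq cX cp) => q; exact: chris_sym.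
rewrite (H k i j) (H k j i) (H i k j); mx_lin.
Qed.

End levi_civita.

(** * Symmetries of the curvature tensor *)

Lemma mx_formE (R : comPzRingType) a b (z : 'rV[R]_a)
    (Q : 'M[R]_(a, b)) (w : 'rV[R]_b) :
  (z *m Q *m w^T) 0 0 = \sum_k \sum_l z 0 k * w 0 l * Q k l.
Proof.
rewrite mxE exchange_big; apply: eq_bigr => l _.
rewrite mxE mulr_suml; apply: eq_bigr => k _.
by rewrite mxE mulrAC.
Qed.

Section curvature_symmetries.
Variables (R : realType) (n : nat) (X : riemannian_manifold R n) (c : chart X).
Variable p : X.
Hypothesis cp : dom c p.
Implicit Types (x y z w : 'rV[R]_n).

Let g := metric c p.
Let rm i j k l := (curv_mx c i j p *m g) k l.

Let rm_antil i j k l : rm j i k l = - rm i j k l.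
Proof. by rewrite /rm (curv_mx_anti c i j p) mulNmx oppmxE. Qed.

Let rm_antir i j k l : rm i j l k = - rm i j k l.
Proof.
have := curv_mx_metric i j cp; have gT : g^T = g := Defs.metric_sym cp.
rewrite -/g -{2}gT -trmx_mul.
by move=> /matrixP/(_ k l); rewrite addmxE [trmx _ _ _]mxE zeromxE /rm; lra.
Qed.

Let rm_bianchi i j k l : rm i j k l + rm j k i l + rm k i j l = 0.
Proof.
have /(congr1 (mulmx^~ g)) := bianchi i j k cp.
rewrite !mulmxDl mul0mx -!row_mul => /rowP/(_ l).
by rewrite !addmxE zeromxE ![row _ _ _ _]mxE.
Qed.

(** Follows linearly from the antisymmetries and the Bianchi identities for the
    four cyclic permutations of the indices. *)
Let rm_pair i j k l : rm i j k l = rm k l i j.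
Proof.
have b1 := rm_bianchi i j k l.
have := rm_bianchi j k l i.
rewrite (rm_antir j k i l) (rm_antir k l i j) (rm_antil j l k i) => b2.
have := rm_bianchi k l i j.
rewrite (rm_antil i l k j) (rm_antir i l j k) (rm_antil k i l j) (rm_antir k i
  j l).
move=> b3; have := rm_bianchi l i j k.
rewrite (rm_antil i l j k) (rm_antir i j k l) (rm_antir j l k i) => b4.
lra.
Qed.

Lemma curv_form_anti x y : curv_form c p y x = - curv_form c p x y.
Proof.
rewrite /curv_form exchange_big -sumrN; apply: eq_bigr => i _.
rewrite -sumrN; apply: eq_bigr => j _.
by rewrite (curv_mx_anti c i j p) scalerN mulrC.
Qed.

Lemma curv_form_metric x y : (curv_form c p x y *m g)^T = - (curv_form c p x y
  *m g).
Proof.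
rewrite /curv_form mulmx_suml linear_sum -sumrN; apply: eq_bigr => i _ /=.
rewrite mulmx_suml linear_sum -sumrN; apply: eq_bigr => j _ /=.
rewrite -scalemxAl linearZ /= -scalerN; congr (_ *: _).
apply/matrixP => k l; rewrite [LHS]mxE oppmxE; exact: rm_antir.
Qed.

Let rmE x y z w : (z *m (curv_form c p x y *m g) *m w^T) 0 0 =
  \sum_i \sum_j \sum_k \sum_l x 0 i * y 0 j * (z 0 k * w 0 l) * rm i j k l.
Proof.
rewrite mulmx_suml mulmx_sumr mulmx_suml summxE; apply: eq_bigr => i _.
rewrite mulmx_suml mulmx_sumr mulmx_suml summxE; apply: eq_bigr => j _.
rewrite -scalemxAl -scalemxAr -scalemxAl mxE mx_formE mulr_sumr.
apply: eq_bigr => k _; rewrite mulr_sumr; apply: eq_bigr => l _.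
exact: mulrA.
Qed.

Lemma curv_form_pair x y z w :
  (z *m (curv_form c p x y *m g) *m w^T) 0 0
  = (x *m (curv_form c p z w *m g) *m y^T) 0 0.
Proof.
rewrite !rmE.
under eq_bigr do rewrite exchange_big /=.
rewrite exchange_big; apply: eq_bigr => k _ /=.
under eq_bigr do rewrite exchange_big /=.
rewrite exchange_big; apply: eq_bigr => l _ /=.
apply: eq_bigr => i _; apply: eq_bigr => j _.
by rewrite rm_pair [x _ _ * _ * _]mulrC.
Qed.

End curvature_symmetries.

(** * Curvature of Kaehler manifolds *)

Lemma mx_form_inj (R : comNzRingType) a b (V W : 'M[R]_(a, b)) :
  (forall (x : 'rV[R]_a) (y : 'rV[R]_b),
     (x *m V *m y^T) 0 0 = (x *m W *m y^T) 0 0) -> V = W.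
Proof.
move=> VW; apply/matrixP => i j.
have E (U : 'M[R]_(a, b)) :
    (@delta_mx R 1 a 0 i *m U *m (@delta_mx R 1 b 0 j)^T) 0 0 = U i j.
  by rewrite -rowE trmx_delta -colE !mxE.
by have := VW (delta_mx 0 i) (delta_mx 0 j); rewrite !E.
Qed.

Lemma mx_formT (R : comPzRingType) a b (z : 'rV[R]_a)
    (Q : 'M[R]_(a, b)) (w : 'rV[R]_b) :
  (z *m Q *m w^T) 0 0 = (w *m Q^T *m z^T) 0 0.
Proof.
rewrite !mx_formE exchange_big; apply: eq_bigr => l _; apply: eq_bigr => k _.
by rewrite mxE [z 0 k * _]mulrC.
Qed.

Section kaehler.
Variables (R : realType) (m : nat) (M : kaehler_manifold R m) (d : chart M).
Implicit Types (p : M) (i j : 'I_m).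

Let dM : open_in d (dom d) := open_in_dom d.
Local Notation J := (cstruct d).
Local Notation G := (metric d).

Lemma smooth_cstruct : smooth_mx d (dom d) J.
Proof. by move=> i j; exact: cstruct_smooth. Qed.

Lemma cstruct_isometry p : dom d p -> J p *m G p *m (J p)^T = G p.
Proof.
move=> dp; apply: mx_form_inj => x y.
by rewrite -[RHS](cstruct_hermitian x y dp) /inner trmx_mul !mulmxA.
Qed.

(** An isometry of square -1 is skew-adjoint. *)
Lemma cstruct_metric_anti p : dom d p -> G p *m (J p)^T = - (J p *m G p).
Proof.
move=> dp; rewrite -[in RHS](cstruct_isometry dp) !mulmxA cstruct_sqr //.
by rewrite !mulNmx mul1mx opprK.
Qed.

Lemma pd_mx_cstruct i p : dom d p ->
  pd_mx d i J p = chris_mx d i p *m J p - J p *m chris_mx d i p.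
Proof.
move=> dp; apply/eqP; rewrite eq_sym subr_eq eq_sym; apply/eqP/matrixP => j k.
rewrite addmxE pd_mxE !mxE.
have := cstruct_parallel i j k dp.
under eq_bigr do rewrite -chris_mxE.
by under [in RHS]eq_bigr do rewrite -chris_mxE.
Qed.

(** The second derivatives of J commute; express them through the connection,
    for which J is parallel. *)
Lemma curv_mx_cstruct i j p : dom d p ->
  curv_mx d i j p *m J p = J p *m curv_mx d i j p.
Proof.
move=> dp; set j0 := J p.
have dd a b : pd_mx d a (pd_mx d b J) p =
    pd_mx d a (chris_mx d b) p *m j0 + chris_mx d b p *m pd_mx d a J p
    - (pd_mx d a J p *m chris_mx d b p + j0 *m pd_mx d a (chris_mx d b) p).
  rewrite (pd_mx_eq dM dp (V := pd_mx d b J) _ (fun q => @pd_mx_cstruct b q)).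
  have sJ := smooth_cstruct; have sG := @smooth_chris _ _ _ d b.
  by rewrite (pd_mxB dM dp) ?(pd_mxM dM dp) //; exact: (smooth_mxM dM).
have := pd_mx_comm dM dp i j smooth_cstruct; rewrite !dd !pd_mx_cstruct // -/j0.
rewrite curv_mxE !(mulmxDl, mulmxDr, mulNmx, mulmxN) !mulmxA => /eqP.
rewrite -subr_eq0 => /eqP H; apply/eqP; rewrite -subr_eq0 -H; apply/eqP; mx_lin.
Qed.

Lemma curv_form_cstruct p x y : dom d p ->
  J p *m curv_form d p x y = curv_form d p x y *m J p.
Proof.
move=> dp; rewrite mulmx_sumr mulmx_suml; apply: eq_bigr => i _.
rewrite mulmx_sumr mulmx_suml; apply: eq_bigr => j _.
by rewrite -scalemxAl -scalemxAr curv_mx_cstruct.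
Qed.

(** <K(x, Jw) Jw, x> = <K(Jx, w) w, Jx>: pass J across K twice, using the
    pair symmetry in between. *)
Lemma kaehler_curvature p x w : dom d p ->
  (w *m J p *m (curv_form d p x (w *m J p) *m G p) *m x^T) 0 0
  = (w *m (curv_form d p (x *m J p) w *m G p) *m (x *m J p)^T) 0 0.
Proof.
move=> dp.
have swap a b (v : 'rV[R]_m) : (v *m J p *m (curv_form d p a b *m G p) *m x^T)
  0 0
   = - (v *m (curv_form d p a b *m G p) *m (x *m J p)^T) 0 0.
  rewrite -oppmxE; congr (fun_of_matrix _ 0 0).
  rewrite trmx_mul !mulmxA -[v *m J p *m _]mulmxA curv_form_cstruct //.
  rewrite -[in RHS](mulmxA _ (G p)) cstruct_metric_anti // mulmxN mulNmx opprK.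
  by rewrite !mulmxA.
rewrite swap curv_form_pair //.
have flip a b (v v' : 'rV[R]_m) : (v *m (curv_form d p a b *m G p) *m v'^T) 0 0
    = - (v' *m (curv_form d p a b *m G p) *m v^T) 0 0.
  by rewrite mx_formT curv_form_metric // mulmxN mulNmx oppmxE.
by rewrite flip opprK swap curv_form_anti mulNmx mulmxN mulNmx oppmxE opprK.
Qed.

End kaehler.

(** * The pulled back connection *)

Section pullback_definitions.
Variables (R : realType) (n m : nat).
Variables (N : charted_space R n) (M : riemannian_manifold R m) (f : N -> M).
Variables (c : chart N) (d : chart M).

(** Connection matrix of the pull-back by f of the tangent bundle of M, in the
    frame given by the chart d. *)
Definition pull_chris (i : 'I_n) (q : N) : 'M[R]_m :=
  \sum_a dmap f c d q i a *: chris_mx d a (f q).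

(** Row j is the ambient derivative nabla^M_{d_i} (f_* d_j). *)
Definition hess_mx (i : 'I_n) (q : N) : 'M[R]_(n, m) :=
  pd_mx c i (dmap f c d) q + dmap f c d q *m pull_chris i q.

End pullback_definitions.

(** Row j is B(d_i, d_j), defined as the difference of the ambient and the
    intrinsic derivative; that it is the normal part is shown below. *)
Definition second_mx (R : realType) (n m : nat)
    (N : riemannian_manifold R n) (M : riemannian_manifold R m) (f : N -> M)
    (c : chart N) (d : chart M) (i : 'I_n) (q : N) : 'M[R]_(n, m) :=
  hess_mx f c d i q - chris_mx c i q *m dmap f c d q.

Section pullback.
Variables (R : realType) (n m : nat).
Variables (N : riemannian_manifold R n) (M : riemannian_manifold R m).
Variables (f : N -> M) (c : chart N) (d : chart M).
Hypothesis fsm : smooth_map f.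

Definition pull_dom : set N := dom c `&` f @^-1` dom d.

Lemma open_in_pull : open_in c pull_dom.
Proof.
split; last by move=> p [].
apply: openI; first exact: open_dom.
by move/continuousP: (fsm.1); apply; exact: open_dom.
Qed.

Let cA := open_in_pull.
Let dM : open_in d (dom d) := open_in_dom d.
Let fc q : pull_dom q -> {for q, continuous f}.
Proof. by move=> _; exact: fsm.1. Qed.
Let fA q : pull_dom q -> dom d (f q).
Proof. by case. Qed.
Let sf k : smooth_on c pull_dom (fun q => lcoord d (f q) 0 k) := fsm.2 c d k.

Local Notation A := pull_dom.
Local Notation D := (dmap f c d).
Local Notation Gf := (fun q => metric d (f q)).
Local Notation con := (pull_chris f c d).
Local Notation S := (hess_mx f c d).
Local Notation B := (second_mx f c d).

Lemma smooth_pull a b (W : M -> 'M[R]_(a, b)) :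
  smooth_mx d (dom d) W -> smooth_mx c A (fun q => W (f q)).
Proof. exact: (smooth_mx_comp cA dM fc fA sf). Qed.

Lemma smooth_pull_dmap : smooth_mx c A D.
Proof. exact: smooth_dmap sf. Qed.

Lemma pd_mx_pull a b (W : M -> 'M[R]_(a, b)) i p : A p -> smooth_mx d (dom d) W
  ->
  pd_mx c i (fun q => W (f q)) p = \sum_k D p i k *: pd_mx d k W (f p).
Proof. exact: (pd_mx_comp cA dM fc fA sf). Qed.

Let smooth_D_entry i a : smooth_on c A (fun q => D q i a).
Proof. exact: smooth_pull_dmap. Qed.

Lemma smooth_pull_chris i : smooth_mx c A (con i).
Proof.
apply: smooth_mx_sum => // a; apply: smooth_mxZ => //.
by apply: smooth_pull; exact: smooth_chris.
Qed.

Lemma smooth_hess i : smooth_mx c A (S i).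
Proof.
apply: smooth_mxD => //; first exact: (smooth_pd_mx i smooth_pull_dmap).
by apply: smooth_mxM => //; exact: smooth_pull_chris.
Qed.

Lemma smooth_chris_pull i : smooth_mx c A (chris_mx c i).
Proof.
move=> j k; apply: smooth_onW (@smooth_chris _ _ N c i j k).
by move=> q [].
Qed.

Lemma smooth_second i : smooth_mx c A (B i).
Proof.
apply: smooth_mxB => //; first exact: smooth_hess.
by apply: smooth_mxM => //; exact: smooth_chris_pull.
Qed.

Lemma pd_mx_pull_metric i p : A p ->
  pd_mx c i Gf p = con i p *m Gf p + Gf p *m (con i p)^T.
Proof.
move=> Ap; have dp := fA Ap; rewrite pd_mx_pull //; last exact: smooth_metric.
rewrite mulmx_suml linear_sum mulmx_sumr -big_split; apply: eq_bigr => a _ /=.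
by rewrite pd_mx_metric // scalerDr scalemxAl [(_ *: _)^T]linearZ /= -scalemxAr.
Qed.

(** Absence of torsion, for vectors tangent to N. *)
Lemma row_hess_sym i j p : A p -> row j (S i p) = row i (S j p).
Proof.
move=> Ap; rewrite !linearD /= (dmap_comm cA sf i j Ap); congr (_ + _).
rewrite !row_mul !mulmx_sumr.
transitivity (\sum_a \sum_b (D p i a * D p j b) *: row b (chris_mx d a (f p))).
  apply: eq_bigr => a _; rewrite -scalemxAr mulmx_sum_row scaler_sumr.
  by apply: eq_bigr => b _; rewrite scalerA [row _ _ _ _]mxE.
rewrite exchange_big; apply: eq_bigr => b _.
rewrite -scalemxAr mulmx_sum_row scaler_sumr; apply: eq_bigr => a _.
by rewrite scalerA [row _ _ _ _]mxE mulrC (chris_sym _ _ (fA Ap)).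
Qed.

(** The second derivatives of f cancel, and what remains is the curvature of M
    by the chain rule. *)
Lemma pull_curvature i j p : A p ->
  pd_mx c i (con j) p - pd_mx c j (con i) p
  + (con j p *m con i p - con i p *m con j p)
  = curv_form d (f p) (row i (D p)) (row j (D p)).
Proof.
move=> Ap; have dp := fA Ap.
have dcon a b : pd_mx c a (con b) p = \sum_l (pd_mx c a D p b l *: chris_mx d l
  (f p))
    + \sum_k \sum_l (D p a k * D p b l) *: pd_mx d k (chris_mx d l) (f p).
  have sC l := smooth_pull (@smooth_chris _ _ M d l).
  rewrite (pd_mx_sum Ap) => [|l]; last by apply: smooth_mxZ.
  rewrite [X in _ = _ + X]exchange_big -big_split; apply: eq_bigr => l _ /=.
  rewrite (pd_mxZ cA Ap) //; congr (_ + _); first by rewrite pd_mxE.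
  rewrite pd_mx_pull //; last exact: smooth_chris.
  by rewrite scaler_sumr; apply: eq_bigr => k _; rewrite scalerA mulrC.
have prod a b : con a p *m con b p = \sum_k \sum_l
    (D p a k * D p b l) *: (chris_mx d k (f p) *m chris_mx d l (f p)).
  rewrite mulmx_suml; apply: eq_bigr => k _; rewrite mulmx_sumr.
  by apply: eq_bigr => l _; rewrite -scalemxAl -scalemxAr scalerA.
have -> : pd_mx c i (con j) p - pd_mx c j (con i) p
    = \sum_k \sum_l (D p i k * D p j l) *:
        (pd_mx d k (chris_mx d l) (f p) - pd_mx d l (chris_mx d k) (f p)).
  rewrite !dcon.
  have -> : \sum_l pd_mx c j D p i l *: chris_mx d l (f p)
          = \sum_l pd_mx c i D p j l *: chris_mx d l (f p).
    apply: eq_bigr => l _; congr (_ *: _).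
    by have /rowP/(_ l) := dmap_comm cA sf i j Ap; rewrite ![row _ _ _ _]mxE.
  rewrite [X in _ - (_ + X)]exchange_big opprD addrACA subrr add0r -sumrB;
    apply: eq_bigr => k _.
  rewrite -sumrB; apply: eq_bigr => l _.
  by rewrite scalerBr [D p j l * _]mulrC.
rewrite !prod [X in X - _]exchange_big -sumrB -big_split; apply: eq_bigr => k _.
rewrite -sumrB -big_split; apply: eq_bigr => l _ /=.
by rewrite curv_mxE ![row _ _ _ _]mxE !(scalerDr, scalerN) [D p j l * _]mulrC.
Qed.

End pullback.

(** * The Gauss formula and the Gauss equation *)

Section gauss.
Variables (R : realType) (n m : nat).
Variables (N : riemannian_manifold R n) (M : riemannian_manifold R m).
Variables (f : N -> M) (c : chart N) (d : chart M).
Hypothesis subf : submanifold f.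

Let fsm : smooth_map f. Proof. by case: subf. Qed.

Local Notation A := (pull_dom f c d).
Local Notation D := (dmap f c d).
Local Notation g := (metric c).
Local Notation Gf := (fun q => metric d (f q)).
Local Notation con := (pull_chris f c d).
Local Notation S := (hess_mx f c d).
Local Notation B := (second_mx f c d).

Let cA : open_in c A := open_in_pull c d fsm.

Lemma pull_metric p : A p -> D p *m Gf p *m (D p)^T = g p.
Proof. by case: subf => _ _ H [cp dp]; rewrite -H. Qed.

Let sD : smooth_mx c A D := smooth_pull_dmap fsm.
Let sG : smooth_mx c A Gf := smooth_pull fsm (@smooth_metric _ _ M d).
Let sDT := smooth_mxT sD.

Lemma pd_mx_induced_metric i p : A p ->
  pd_mx c i g p = S i p *m Gf p *m (D p)^T + (S i p *m Gf p *m (D p)^T)^T.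
Proof.
move=> Ap; have [cp dp] := Ap.
have -> : pd_mx c i g p = pd_mx c i (fun q => D q *m Gf q *m (D q)^T) p.
  by apply: (pd_mx_eq cA Ap) => q Aq; rewrite pull_metric.
rewrite (pd_mxM cA Ap) ?pd_mxT //; last exact: (smooth_mxM cA).
rewrite (pd_mxM cA Ap) // pd_mx_pull_metric // /hess_mx.
rewrite !trmx_mul !trmxK (Defs.metric_sym dp) !tr_addmx trmx_mul.
rewrite !(mulmxDl, mulmxDr) !mulmxA; mx_lin.
Qed.

(** Uniqueness of the Levi-Civita connection: the tangential part of the
    ambient derivative is symmetric and compatible with the metric. *)
Lemma hess_tangent i p : A p ->
  S i p *m Gf p *m (D p)^T = chris_mx c i p *m g p.
Proof.
move=> Ap; have [cp dp] := Ap; rewrite chris_mx_metric //.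
pose T i := S i p *m Gf p *m (D p)^T.
have Tsym a b k : T a b k = T b a k.
  have /(congr1 (fun r => (r *m Gf p *m (D p)^T) 0 k)) := row_hess_sym fsm a b
    Ap.
  by rewrite -!row_mul ![row _ _ _ _]mxE.
apply/matrixP => j l; rewrite scalemxE [koszul _ _ _ _ _]mxE.
rewrite !pd_mx_induced_metric // -/(T i) -/(T j) -/(T l) !addmxE ![trmx _ _
  _]mxE.
rewrite (Tsym j i l) (Tsym j l i) (Tsym l i j); lra.
Qed.

Lemma second_normal i p : A p -> B i p *m Gf p *m (D p)^T = 0.
Proof.
move=> Ap; rewrite /second_mx !mulmxBl hess_tangent // -!mulmxA.
by rewrite [D p *m _]mulmxA pull_metric // subrr.
Qed.

Lemma hess_split i p : S i p = chris_mx c i p *m D p + B i p.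
Proof. by rewrite /second_mx addrC subrK. Qed.

Lemma row_second_sym i j p : A p -> row j (B i p) = row i (B j p).
Proof.
move=> Ap; rewrite /second_mx !linearB /= (row_hess_sym fsm i j Ap).
by rewrite !row_mul (chris_sym i j Ap.1).
Qed.

(** Differentiate covariantly the decomposition of hess_mx into its tangential
    part and B. The commutator of the left-hand sides is the ambient curvature
    applied to tangent vectors; on the right the derivative of B, which is
    normal, has tangential part given by a product of two values of B. *)
Lemma gauss_equation i j p : A p ->
  D p *m curv_form d (f p) (row i (D p)) (row j (D p)) *m Gf p *m (D p)^T
  = curv_mx c i j p *m g p
    + (B i p *m Gf p *m (B j p)^T - B j p *m Gf p *m (B i p)^T).
Proof.
move=> Ap; have [cp dp] := Ap.
have sC k := smooth_pull_chris fsm k : smooth_mx c A (con k).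
have sN k : smooth_mx c A (chris_mx c k) by exact: smooth_chris_pull.
have sB k := smooth_second fsm k : smooth_mx c A (B k).
(* covariant derivative of the rows of S b, in two ways *)
have dS a b : pd_mx c a (S b) p + S b p *m con a p
    = pd_mx c a (pd_mx c b D) p + pd_mx c a D p *m con b p + D p *m pd_mx c a
      (con b) p
      + (pd_mx c b D p *m con a p + D p *m con b p *m con a p).
  rewrite /hess_mx (pd_mxD Ap); last 2 first.
  - exact: (smooth_pd_mx b sD).
  - exact: (smooth_mxM cA).
  by rewrite (pd_mxM cA Ap) // mulmxDl !addrA.
have dB a b : (pd_mx c a (B b) p + B b p *m con a p) *m Gf p *m (D p)^T
    = - (B b p *m Gf p *m (B a p)^T
        + B b p *m Gf p *m (D p)^T *m (chris_mx c a p)^T).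
  have : pd_mx c a (fun q => B b q *m Gf q *m (D q)^T) p = 0.
    rewrite -(pd_mx_cst c p 0 a); apply: (pd_mx_eq cA Ap) => q Aq.
    exact: second_normal.
  rewrite (pd_mxM cA Ap) ?pd_mxT //; last exact: (smooth_mxM cA).
  rewrite (pd_mxM cA Ap) // pd_mx_pull_metric // => H.
  have BS : B b p *m Gf p *m (B a p)^T
        + B b p *m Gf p *m (D p)^T *m (chris_mx c a p)^T
      = B b p *m Gf p *m (S a p)^T.
    rewrite hess_split [(chris_mx c a p *m _ + _)^T]tr_addmx trmx_mul mulmxDr.
    by rewrite !mulmxA addrC.
  rewrite BS /hess_mx [(_ + _)^T]tr_addmx trmx_mul; apply/eqP; rewrite
    -subr_eq0 -H.
  apply/eqP; rewrite !(mulmxDl, mulmxDr) !mulmxA; mx_lin.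
have dS' a b : pd_mx c a (S b) p + S b p *m con a p
    = pd_mx c a (chris_mx c b) p *m D p + chris_mx c b p *m S a p
      + (pd_mx c a (B b) p + B b p *m con a p).
  have -> : pd_mx c a (S b) p = pd_mx c a (fun q => chris_mx c b q *m D q + B b
    q) p.
    by apply: (pd_mx_eq cA Ap) => q Aq; rewrite hess_split.
  rewrite (pd_mxD Ap) //; last exact: (smooth_mxM cA).
  rewrite (pd_mxM cA Ap) // [S b p]hess_split /hess_mx.
  rewrite !(mulmxDl, mulmxDr) !mulmxA; mx_lin.
have E : D p *m curv_form d (f p) (row i (D p)) (row j (D p))
    = (pd_mx c i (S j) p + S j p *m con i p) - (pd_mx c j (S i) p + S i p *m
      con j p).
  rewrite -(pull_curvature fsm i j Ap) !dS (pd_mx_comm cA Ap i j) //.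
  rewrite !(mulmxDl, mulmxDr, mulmxN) !mulmxA; mx_lin.
have dSN a b : (pd_mx c a (S b) p + S b p *m con a p) *m Gf p *m (D p)^T
    = pd_mx c a (chris_mx c b) p *m g p + chris_mx c b p *m chris_mx c a p *m g
      p
      - B b p *m Gf p *m (B a p)^T.
  rewrite dS' 2!mulmxDl dB second_normal // mul0mx addr0; congr (_ - _).
  rewrite 2!mulmxDl -!mulmxA [D p *m _]mulmxA pull_metric //.
  by rewrite [S a p *m _]mulmxA hess_tangent.
rewrite E 2!mulmxBl !dSN curv_mxE !(mulmxDl, mulNmx); mx_lin.
Qed.

End gauss.

(** * Contractions at a point *)

Section curv_form_linear.
Variables (R : realType) (n k : nat) (X : riemannian_manifold R n).
Variables (c : chart X) (p : X).
Implicit Types (x : 'rV[R]_k) (z : 'rV[R]_n) (D : 'M[R]_(k, n)).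

Lemma curv_form_mull x D z :
  curv_form c p (x *m D) z = \sum_i x 0 i *: curv_form c p (row i D) z.
Proof.
rewrite /curv_form; under [RHS]eq_bigr do rewrite scaler_sumr.
rewrite [RHS]exchange_big; apply: eq_bigr => j _ /=.
under [RHS]eq_bigr do rewrite scaler_sumr.
rewrite [RHS]exchange_big; apply: eq_bigr => l _ /=.
rewrite [(x *m D) _ _]mxE mulr_suml scaler_suml; apply: eq_bigr => i _.
by rewrite [row _ _ _ _]mxE scalerA mulrA.
Qed.

Lemma curv_form_mulr z x D :
  curv_form c p z (x *m D) = \sum_i x 0 i *: curv_form c p z (row i D).
Proof.
rewrite curv_form_anti curv_form_mull -sumrN; apply: eq_bigr => i _.
by rewrite -scalerN -curv_form_anti.
Qed.

End curv_form_linear.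

Section pointwise.
Variables (R : realType) (n m : nat).
Variables (N : riemannian_manifold R n) (M : riemannian_manifold R m).
Variables (f : N -> M) (c : chart N) (d : chart M).
Hypothesis subf : submanifold f.

Local Notation A := (pull_dom f c d).
Local Notation D := (dmap f c d).
Local Notation B := (second_mx f c d).

Variable p : N.
Hypothesis Ap : A p.
Let cp : dom c p := Ap.1.
Let dp : dom d (f p) := Ap.2.
Local Notation E := (frame c p).
Local Notation T := (tframe f c d p).
Local Notation G := (metric d (f p)).

Lemma tframeP : T *m G *m T^T = 1%:M.
Proof.
by rewrite /tframe trmx_mul !mulmxA -(mulmxA E) -(mulmxA E) pull_metric //
  frameP.
Qed.

(** The Gram matrix of the tangent frame does not depend on the frame, so that
    the normal part can be computed in the coordinate basis. *)
Lemma tframe_gram : T^T *m T = (D p)^T *m invmx (metric c p) *m D p.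
Proof.
by rewrite /tframe trmx_mul mulmxA -[_ *m E]mulmxA (orthonormal_inv (frameP
  cp)).
Qed.

Lemma normal_partE w : normal_part f c d p w = w - w *m G *m (T^T *m T).
Proof.
congr (_ - _); rewrite mulmxA [RHS]mulmx_sum_row; apply: eq_bigr => i _.
congr (_ *: _); rewrite /inner !mxE; apply: eq_bigr => j _; by rewrite !mxE.
Qed.

Lemma normal_part_tangent x : normal_part f c d p (x *m D p) = 0.
Proof.
rewrite normal_partE tframe_gram -!mulmxA [G *m _]mulmxA [D p *m _]mulmxA.
rewrite [D p *m (G *m _)]mulmxA pull_metric // mulKVmx ?subrr //.
exact: metric_unit.
Qed.

Lemma normal_part_normal w : w *m G *m (D p)^T = 0 -> normal_part f c d p w = w.
Proof.
by move=> w0; rewrite normal_partE tframe_gram !mulmxA w0 !mul0mx subr0.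
Qed.

Lemma normal_partD w w' :
  normal_part f c d p (w + w') = normal_part f c d p w + normal_part f c d p w'.
Proof. by rewrite !normal_partE !mulmxDl opprD addrACA. Qed.

Lemma row_nabla_along w i : row i (nabla_along f c d w p)
  = pd_mx c i w p + w p *m pull_chris f c d i p.
Proof.
apply/rowP => k; rewrite addmxE [row _ _ _ _]mxE [nabla_along _ _ _ _ _ _ _]mxE.
rewrite pd_mxE; congr (_ + _); rewrite exchange_big mxE; apply: eq_bigr => b _.
rewrite summxE mulr_sumr; apply: eq_bigr => a _.
by rewrite scalemxE chris_mxE [RHS]mulrA [w p 0 b * _]mulrC.
Qed.

Lemma row_nabla u i : row i (nabla c u p) = pd_mx c i (u c) p + u c p *m
  chris_mx c i p.
Proof.
apply/rowP => k; rewrite addmxE [row _ _ _ _]mxE [nabla _ _ _ _ _]mxE.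
rewrite pd_mxE; congr (_ + _); rewrite mxE; apply: eq_bigr => b _.
by rewrite chris_mxE.
Qed.

(** The second fundamental form with its first argument contracted. *)
Definition second_along (x : 'rV[R]_n) : 'M[R]_(n, m) := \sum_i x 0 i *: B i p.

Lemma second_along_normal x : second_along x *m G *m (D p)^T = 0.
Proof.
rewrite /second_along !mulmx_suml big1 // => i _.
by rewrite -!scalemxAl second_normal // scaler0.
Qed.

Lemma second_formE x y : second_form f c d p x y = y *m second_along x.
Proof.
have -> : y *m second_along x = \sum_i \sum_j (x 0 i * y 0 j) *: row j (B i p).
  rewrite mulmx_sumr; apply: eq_bigr => i _.
  rewrite -scalemxAr mulmx_sum_row scaler_sumr; apply: eq_bigr => j _.
  by rewrite scalerA.
rewrite /second_form.
have np0 : normal_part f c d p 0 = 0.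
  by rewrite -[X in normal_part _ _ _ _ X](mul0mx _ (D p)) normal_part_tangent.
rewrite (big_morph _ normal_partD np0); apply: eq_bigr => i _.
rewrite (big_morph _ normal_partD np0); apply: eq_bigr => j _.
have -> : row i (nabla_along f c d (fun q => row j (D q)) p)
    = row j (hess_mx f c d i p).
  by rewrite row_nabla_along pd_mx_row -row_mul -linearD.
rewrite normal_partE hess_split.
rewrite -scalemxAl -scalemxAl -scalerBr -normal_partE; congr (_ *: _).
rewrite linearD /= row_mul normal_partD normal_part_tangent add0r.
apply: normal_part_normal; rewrite -!row_mul second_normal //.
by apply/rowP => k; rewrite !mxE.
Qed.

Lemma second_along_sym x y : y *m second_along x = x *m second_along y.
Proof.
rewrite /second_along !mulmx_sumr.
under eq_bigr do rewrite -scalemxAr mulmx_sum_row scaler_sumr.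
rewrite exchange_big; apply: eq_bigr => i _.
rewrite -scalemxAr mulmx_sum_row scaler_sumr; apply: eq_bigr => j _.
by rewrite !scalerA mulrC (row_second_sym subf j i Ap).
Qed.

Lemma gauss_contracted x y :
  D p *m curv_form d (f p) (x *m D p) (y *m D p) *m G *m (D p)^T
  = curv_form c p x y *m metric c p
    + (second_along x *m G *m (second_along y)^T
       - second_along y *m G *m (second_along x)^T).
Proof.
have L : curv_form d (f p) (x *m D p) (y *m D p) =
    \sum_i \sum_j (x 0 i * y 0 j) *: curv_form d (f p) (row i (D p)) (row j (D
      p)).
  rewrite curv_form_mull; apply: eq_bigr => i _.
  rewrite curv_form_mulr scaler_sumr; apply: eq_bigr => j _.
  by rewrite scalerA.
rewrite L.
have SS a b : second_along a *m G *m (second_along b)^T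
   = \sum_i \sum_j (a 0 i * b 0 j) *: (B i p *m G *m (B j p)^T).
  rewrite /second_along !mulmx_suml; apply: eq_bigr => i _.
  rewrite linear_sum mulmx_sumr; apply: eq_bigr => j _ /=.
  by rewrite linearZ /= -!scalemxAl -scalemxAr scalerA.
rewrite !SS [X in _ = _ + (_ - X)]exchange_big -sumrB.
rewrite mulmx_suml -big_split mulmx_sumr !mulmx_suml; apply: eq_bigr => i _ /=.
rewrite mulmx_suml -sumrB -big_split mulmx_sumr !mulmx_suml; apply: eq_bigr =>
  j _ /=.
rewrite -scalemxAr -!scalemxAl gauss_equation //.
by rewrite [y 0 j * _]mulrC !(scalerDr, scalerN).
Qed.

End pointwise.

(** * Totally real minimal submanifolds of half the dimension *)

Section ricci_trace.
Variables (R : realType) (n : nat) (X : riemannian_manifold R n).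
Variables (c : chart X) (p : X).
Implicit Types (x w : 'rV[R]_n).

(** The endomorphism x |-> K(x, w) w. *)
Definition jacobi_mx w : 'M[R]_n :=
  \matrix_k (w *m curv_form c p (row k 1%:M) w).

Lemma mul_jacobi_mx x w : w *m curv_form c p x w = x *m jacobi_mx w.
Proof.
rewrite -{1}[x]mulmx1 curv_form_mull mulmx_sumr mulmx_sum_row.
by apply: eq_bigr => k _; rewrite -scalemxAr rowK.
Qed.

Lemma sum_jacobi k (T : 'M[R]_(k, n)) w :
  \sum_i inner c p (curvature c p (row i T) w w) (row i T)
  = \tr (jacobi_mx w *m metric c p *m (T^T *m T)).
Proof.
rewrite -sum_row_form; apply: eq_bigr => i _.
by rewrite /inner curvatureE mul_jacobi_mx !mulmxA.
Qed.

Lemma ricci_trace w : dom c p ->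
  ricci c p w w = \tr (jacobi_mx w *m metric c p *m invmx (metric c p)).
Proof. by move=> cp; rewrite /ricci sum_jacobi (orthonormal_inv (frameP cp)).
  Qed.

End ricci_trace.

Section lagrangian.
Variables (R : realType) (n m : nat).
Variables (N : riemannian_manifold R n) (M : kaehler_manifold R m).
Variables (f : N -> M) (c : chart N) (d : chart M).
Hypotheses (subf : submanifold f) (minf : minimal f) (realf : totally_real f).
Hypothesis dim : (n + n)%N = m.

Let fsm : smooth_map f. Proof. by case: subf. Qed.

Local Notation A := (pull_dom f c d).
Local Notation D := (dmap f c d).
Local Notation B := (second_mx f c d).
Local Notation Jf := (fun q => cstruct d (f q)).
Local Notation Gf := (fun q => metric d (f q)).
Local Notation con := (pull_chris f c d).

Let cA : open_in c A := open_in_pull c d fsm.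

Lemma real_mx q : A q -> D q *m Jf q *m Gf q *m (D q)^T = 0.
Proof.
move=> [cq dq]; apply: mx_form_inj => x y.
have := @realf c d q x y cq dq; rewrite /inner trmx_mul !mulmxA => ->.
by rewrite mulmx0 mul0mx mxE.
Qed.

Lemma real_mxT q : A q -> D q *m Gf q *m (Jf q)^T *m (D q)^T = 0.
Proof.
move=> Aq; have [_ dq] := Aq.
rewrite -(mulmxA (D q) (Gf q)) cstruct_metric_anti // mulmxN mulNmx.
by rewrite mulmxA real_mx // oppr0.
Qed.

Lemma pd_mx_pull_cstruct i q : A q ->
  pd_mx c i Jf q = con i q *m Jf q - Jf q *m con i q.
Proof.
move=> Aq; have dq := Aq.2; rewrite (@pd_mx_pull _ _ _ _ _ f c d fsm) //; last
  exact: smooth_cstruct.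
rewrite mulmx_suml mulmx_sumr -sumrB; apply: eq_bigr => a _ /=.
by rewrite pd_mx_cstruct // scalerBr scalemxAl -scalemxAr.
Qed.

Let sD : smooth_mx c A D := smooth_pull_dmap fsm.
Let sG : smooth_mx c A Gf := smooth_pull fsm (@smooth_metric _ _ M d).
Let sJ : smooth_mx c A Jf := smooth_pull fsm (@smooth_cstruct _ _ M d).
Let sDT := smooth_mxT sD.
Let sJT := smooth_mxT sJ.

Variable p : N.
Hypothesis Ap : A p.
Let cp : dom c p := Ap.1.
Let dp : dom d (f p) := Ap.2.
Local Notation E := (frame c p).
Local Notation T := (tframe f c d p).
Local Notation G := (metric d (f p)).
Local Notation J := (cstruct d (f p)).
Local Notation Bx := (second_along f c d p).

(** <B(X, Y), JZ> is symmetric in Y and Z: differentiate <Y, JZ> = 0. *)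
Lemma second_real_sym i :
  (B i p *m G *m J^T *m (D p)^T)^T = B i p *m G *m J^T *m (D p)^T.
Proof.
have BS : B i p *m G *m J^T *m (D p)^T = hess_mx f c d i p *m G *m J^T *m (D
  p)^T.
  rewrite hess_split !mulmxDl -!(mulmxA (chris_mx c i p)) real_mxT //.
  by rewrite mulmx0 add0r.
have H : hess_mx f c d i p *m G *m J^T *m (D p)^T
    + D p *m G *m J^T *m (hess_mx f c d i p)^T = 0.
  have : pd_mx c i (fun q => D q *m Gf q *m (Jf q)^T *m (D q)^T) p = 0.
    rewrite -(pd_mx_cst c p 0 i); apply: (pd_mx_eq cA Ap) => q Aq; exact:
      real_mxT.
  have s1 : smooth_mx c A (fun q => D q *m Gf q) by exact: (smooth_mxM cA).
  have s2 : smooth_mx c A (fun q => D q *m Gf q *m (Jf q)^T).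
    exact: (smooth_mxM cA).
  rewrite (pd_mxM cA Ap) // pd_mxT (pd_mxM cA Ap) // pd_mxT (pd_mxM cA Ap) //.
  rewrite pd_mx_pull_metric // pd_mx_pull_cstruct // => <-.
  rewrite /hess_mx !(tr_addmx, tr_oppmx) !trmx_mul.
  rewrite !(mulmxDl, mulmxDr, mulmxN, mulNmx) !mulmxA; mx_lin.
rewrite BS !trmx_mul trmxK !(Defs.metric_sym dp) mulmxA.
apply/esym/eqP; rewrite -subr_eq0 -{}H; apply/eqP; congr (_ + _).
rewrite -[D p *m G *m J^T]mulmxA cstruct_metric_anti // mulmxN mulNmx.
by rewrite trmxK !mulmxA.
Qed.

Lemma second_real x y z :
  inner d (f p) (y *m Bx x) (z *m D p *m J) = inner d (f p) (z *m Bx x) (y *m D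
    p *m J).
Proof.
have sym : (Bx x *m G *m J^T *m (D p)^T)^T = Bx x *m G *m J^T *m (D p)^T.
  rewrite /second_along !mulmx_suml linear_sum; apply: eq_bigr => i _ /=.
  by rewrite -!scalemxAl linearZ /= second_real_sym.
have E a b : inner d (f p) (a *m Bx x) (b *m D p *m J)
    = (a *m (Bx x *m G *m J^T *m (D p)^T) *m b^T) 0 0.
  by rewrite /inner !trmx_mul !mulmxA.
by rewrite !E mx_formT sym.
Qed.

(** The tangent space and its image under J span: the two orthonormal families
    together are an orthonormal basis, by the assumption on the dimension. *)
Lemma lagrangian_gram : T^T *m T + (T *m J)^T *m (T *m J) = invmx G.
Proof.
have := @orthonormal_inv_rect R (n + n) m (col_mx T (T *m J)) G dim.
rewrite tr_col_mx mul_row_col; apply.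
rewrite mul_col_mx mul_col_row (tframeP subf Ap) scalar_mx_block.
have TJT : T *m J *m G *m T^T = 0.
  rewrite /tframe trmx_mul -!(mulmxA E) !mulmxA -(mulmxA E) -(mulmxA E)
    -(mulmxA E).
  by rewrite real_mx // mulmx0 mul0mx.
rewrite TJT; congr block_mx.
- have : (T *m J *m G *m T^T)^T = 0 by rewrite TJT trmx0.
  by rewrite !trmx_mul !trmxK (Defs.metric_sym dp) !mulmxA.
- rewrite trmx_mul -(mulmxA T) !mulmxA -(mulmxA T) -(mulmxA T).
  by rewrite cstruct_isometry // tframeP.
Qed.

Lemma metricK : G *m invmx G = 1%:M.
Proof. by rewrite mulmxV // metric_unit. Qed.

(** The images by J of a tangent frame form an orthonormal normal frame. *)
Lemma sqnorm_normal y : y *m G *m (D p)^T = 0 ->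
  sqnorm d (f p) y = \sum_j inner d (f p) y (row j (T *m J)) ^+ 2.
Proof.
move=> y0; have yT : y *m G *m T^T = 0.
  by rewrite /tframe trmx_mul mulmxA y0 mul0mx.
have : (T *m J)^T *m (T *m J) = invmx G - T^T *m T.
  by rewrite -lagrangian_gram addrC addKr.
move: (T *m J) => W WW.
have -> : sqnorm d (f p) y = (y *m G *m W^T *m (y *m G *m W^T)^T) 0 0.
  rewrite /sqnorm /inner; congr (fun_of_matrix _ 0 0).
  rewrite [(y *m G *m _)^T]trmx_mul trmxK [(y *m G)^T]trmx_mul (Defs.metric_sym
    dp).
  rewrite !mulmxA -(mulmxA (y *m G)) WW.
  rewrite mulmxBr mulmxA yT mul0mx subr0 -(mulmxA y G (invmx G)) metricK.
  by rewrite mulmx1.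
rewrite mxE; apply: eq_bigr => j _; rewrite expr2 [_^T _ _]mxE.
have -> : (y *m G *m W^T) 0 j = inner d (f p) y (row j W).
  rewrite /inner !mxE; apply: eq_bigr => k _; by rewrite !mxE.
by [].
Qed.

(** By the symmetry of <B(X, Y), JZ>, the entries <B(e_i, e_j), Ju> are the
    coordinates <B(e_i, u), Je_j> of B(e_i, u) in the normal frame. *)
Lemma second_form_sqnormE u :
  second_form_sqnorm f c d p (u *m D p *m J)
  = \sum_i sqnorm d (f p) (row i E *m Bx u).
Proof.
apply: eq_bigr => i _.
rewrite -(second_along_sym subf Ap) sqnorm_normal; last first.
  by rewrite -!mulmxA [Bx _ *m _]mulmxA second_along_normal // mulmx0.
apply: eq_bigr => j _; rewrite second_formE //; congr (_ ^+ 2).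
by rewrite second_real /tframe -!mulmxA !row_mul !mulmxA.
Qed.

(** Contract the Gauss equation: the term <B(u, u), sum_i B(e_i, e_i)> vanishes
    by minimality. *)
Lemma ricci_gauss u : ricci c p u u =
  partial_ricci f c d p (u *m D p) - \sum_i sqnorm d (f p) (row i E *m Bx u).
Proof.
have min0 : \sum_i row i E *m Bx (row i E) = 0.
  rewrite -[RHS](minf cp dp); apply: eq_bigr => i _.
  by rewrite second_formE.
have -> : ricci c p u u = \sum_i (inner d (f p)
      (curvature d (f p) (row i T) (u *m D p) (u *m D p)) (row i T)
    - sqnorm d (f p) (row i E *m Bx u)
    + (u *m Bx u *m G *m (row i E *m Bx (row i E))^T) 0 0).
  apply: eq_bigr => i _; rewrite /sqnorm /inner !curvatureE /tframe row_mul.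
  set e := row i E.
  have -> : u *m curv_form c p e u *m metric c p *m e^T
    = u *m (curv_form c p e u *m metric c p) *m e^T by rewrite mulmxA.
  have -> : curv_form c p e u *m metric c p =
     D p *m curv_form d (f p) (e *m D p) (u *m D p) *m G *m (D p)^T
     - (Bx e *m G *m (Bx u)^T - Bx u *m G *m (Bx e)^T).
    by rewrite gauss_contracted // addrK.
  rewrite -oppmxE -!addmxE; congr (fun_of_matrix _ 0 0).
  rewrite !(mulmxBr, mulmxBl) !trmx_mul !mulmxA.
  rewrite -[e *m Bx u](second_along_sym subf Ap e u); mx_lin.
rewrite big_split sumrB /=.
suff -> : \sum_i (u *m Bx u *m G *m (row i E *m Bx (row i E))^T) 0 0 = 0.
  by rewrite addr0.
rewrite -summxE -mulmx_sumr -(linear_sum trmx) min0.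
by rewrite linear0 mulmx0 mxE.
Qed.

(** Compute the trace in the basis made of the e_i and the Je_i; the Kaehler
    identity turns <K(Je_i, w) w, Je_i> into <K(e_i, Jw) Jw, e_i>. *)
Lemma ricci_lagrangian w : ricci d (f p) w w
  = partial_ricci f c d p w + partial_ricci f c d p (w *m J).
Proof.
rewrite ricci_trace // -lagrangian_gram mulmxDr linearD /= -!sum_jacobi.
congr (_ + _); apply: eq_bigr => i _; rewrite /inner !curvatureE row_mul.
by have := kaehler_curvature (row i T) w dp; rewrite !mulmxA => ->.
Qed.

(** A normal vector is a combination of the Je_i, and J (Je_i) is tangent. *)
Lemma normal_part_cstruct y : y *m G *m (D p)^T = 0 ->
  normal_part f c d p (y *m J) = 0.
Proof.
move=> yn; have yT : y *m G *m T^T = 0.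
  by rewrite /tframe trmx_mul mulmxA yn mul0mx.
have yE : y = y *m G *m J^T *m T^T *m T *m J.
  rewrite -{1}[y]mulmx1 -metricK -lagrangian_gram [(T *m J)^T]trmx_mul.
  by rewrite !mulmxDr !mulmxA yT !mul0mx add0r.
rewrite normal_partE {1}yE -mulmxA cstruct_sqr // mulmxN mulmx1 -!(mulmxA y).
rewrite !mulmxA -(mulmxA y G) cstruct_metric_anti // mulmxN !mulNmx opprK.
by rewrite !mulmxA subrr.
Qed.

(** As J is parallel, the derivative of Ju is J applied to the ambient
    derivative of u. The tangential part of the latter, the intrinsic
    derivative, is mapped to normal vectors, and its normal part B(X, u) to
    tangent ones, so that only the former contributes. *)
Lemma normal_nabla_sqnormE (u : chart N -> N -> 'rV[R]_n)
    (v : chart M -> N -> 'rV[R]_m) :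
  smooth_mx c A (u c) -> (forall q, A q -> v d q = u c q *m D q *m Jf q) ->
  normal_nabla_sqnorm f c d v p = nabla_sqnorm c u p.
Proof.
move=> su vE; apply: eq_bigr => i _.
have nv k : row k (nabla_along f c d (v d) p)
    = row k (nabla c u p) *m (D p *m J) + u c p *m B k p *m J.
  rewrite row_nabla_along row_nabla (pd_mx_eq cA Ap _ vE) vE //.
  rewrite (pd_mxM cA Ap) //; last exact: (smooth_mxM cA).
  rewrite (pd_mxM cA Ap) // pd_mx_pull_cstruct // /second_mx /hess_mx.
  rewrite !(mulmxDl, mulmxDr, mulmxN, mulNmx) !mulmxA; mx_lin.
have -> : row i (E *m nabla_along f c d (v d) p)
    = row i (E *m nabla c u p) *m D p *m J + u c p *m Bx (row i E) *m J.
  rewrite !row_mul ![row i E *m _]mulmx_sum_row /second_along mulmx_sumr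
    !mulmx_suml.
  rewrite -big_split.
  apply: eq_bigr => k _ /=; rewrite nv scalerDr.
  by rewrite -!scalemxAl -scalemxAr -scalemxAl !mulmxA.
set x := row i _; set y := u c p *m Bx _.
have yn : y *m G *m (D p)^T = 0.
  by rewrite -!mulmxA [Bx _ *m _]mulmxA second_along_normal // mulmx0.
have yJ := normal_part_cstruct yn.
rewrite normal_partD yJ addr0 (normal_part_normal Ap); last first.
  by rewrite -!(mulmxA x) real_mx // mulmx0.
rewrite /sqnorm /inner !trmx_mul; congr (fun_of_matrix _ 0 0).
rewrite -(pull_metric subf Ap) -[in RHS](cstruct_isometry dp) !mulmxA.
by [].
Qed.

End lagrangian.

(** * Tangent fields and normal fields *)

Lemma dmap_comp (R : realType) (n m k : nat) (X : charted_space R n)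
    (Y : charted_space R m) (Z : charted_space R k) (f : X -> Y) (h : Y -> Z)
    (c : chart X) (d : chart Y) (e : chart Z) (p : X) :
  smooth_map f -> smooth_map h ->
  dom c p -> dom d (f p) -> dom e (h (f p)) ->
  dmap (h \o f) c e p = dmap f c d p *m dmap h d e (f p).
Proof.
move=> [fc fs] [hc hs] cp dp ep; apply/matrixP => i l; rewrite [RHS]mxE
  [LHS]dmapE.
rewrite (@pd_comp _ _ _ _ _ f c d p (fc p) cp dp _ (fun y => lcoord e (h y) 0
  l)).
- by apply: eq_bigr => a _; rewrite [dmap h _ _ _ _ _]dmapE.
- by move=> a; apply: smooth_on_pdiff (fs c d a) _.
- by apply: smooth_on_pdiff (hs d e l) _.
Qed.

Section fields.
Variables (R : realType) (n m : nat).
Variables (N : riemannian_manifold R n) (M : kaehler_manifold R m).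
Variable f : N -> M.
Hypotheses (subf : submanifold f) (realf : totally_real f).
Hypothesis dim : (n + n)%N = m.

Let fsm : smooth_map f. Proof. by case: subf. Qed.
Let idN : smooth_map (@id N) := smooth_transition N.
Let idM : smooth_map (@id M) := smooth_transition M.

(** The relation v = Ju, required in all charts as a vector field is a family of
    components. *)
Definition cstruct_image (u : chart N -> N -> 'rV[R]_n)
    (v : chart M -> N -> 'rV[R]_m) : Prop :=
  forall c d q, dom c q -> dom d (f q) ->
    v d q = u c q *m dmap f c d q *m cstruct d (f q).

Lemma dmap_source c c' d q : dom c q -> dom c' q -> dom d (f q) ->
  dmap f c d q = dmap id c c' q *m dmap f c' d q.
Proof. exact: (dmap_comp idN fsm). Qed.

Lemma dmap_target c d d' q : dom c q -> dom d (f q) -> dom d' (f q) ->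
  dmap f c d' q = dmap f c d q *m dmap id d d' (f q).
Proof. exact: (dmap_comp fsm idM). Qed.

(** An explicit left inverse of the differential: f is an immersion. *)
Lemma dmap_leftK c d q (x : 'rV[R]_n) : dom c q -> dom d (f q) ->
  x *m dmap f c d q *m metric d (f q) *m (dmap f c d q)^T
    *m invmx (metric c q) = x.
Proof.
move=> cq dq; rewrite -!(mulmxA x) mulmxA pull_metric //.
by rewrite -(mulmxA x) mulmxV ?mulmx1 // metric_unit.
Qed.

Lemma dmap_inj c d q (x y : 'rV[R]_n) : dom c q -> dom d (f q) ->
  x *m dmap f c d q = y *m dmap f c d q -> x = y.
Proof.
by move=> cq dq xy; rewrite -(dmap_leftK x cq dq) xy dmap_leftK.
Qed.

Lemma smooth_field_entries (c : chart N) A k (w : N -> 'rV[R]_k) :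
  smooth_mx c A w <-> forall j, smooth_on c A (fun q => w q 0 j).
Proof. by split=> [sw j|sw i j]; [exact: sw|rewrite ord1; exact: sw]. Qed.

Let smooth_J c d : smooth_mx c (pull_dom f c d) (fun q => cstruct d (f q)) :=
  smooth_pull fsm (@smooth_cstruct _ _ M d).
Let smooth_G c d : smooth_mx c (pull_dom f c d) (fun q => metric d (f q)) :=
  smooth_pull fsm (@smooth_metric _ _ M d).
Let smooth_D c d : smooth_mx c (pull_dom f c d) (dmap f c d) :=
  smooth_pull_dmap fsm.

(** Ju is well defined by the transformation rules, and normal because N is
    totally real. *)
Lemma vector_field_normal u : vector_field u ->
  exists2 v, normal_field f v & cstruct_image u v.
Proof.
move=> [us uc].
pose v d q := u (chart_at q) q *m dmap f (chart_at q) d q *m cstruct d (f q).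
have uv : cstruct_image u v.
  move=> c d q cq dq; rewrite /v; congr (_ *m _).
  have c0 := mem_chart_at q.
  by rewrite (uc c _ _ cq c0) -mulmxA -dmap_source.
exists v => //; split=> [c d k|d d' p dp dp'|c d p x cp dp].
- apply: (proj1 (smooth_field_entries c _ (v d)) _ k) => {k}.
  have cA := open_in_pull c d fsm.
  apply: (@smooth_mx_eq _ _ _ c _ cA _ _ _
    (fun q => u c q *m dmap f c d q *m cstruct d (f q))).
    by move=> q [cq dq]; exact: uv.
  apply: (smooth_mxM cA); last exact: smooth_J.
  apply: (smooth_mxM cA); last exact: smooth_D.
  apply/smooth_field_entries => j; apply: smooth_onW (us c j).
  by move=> q [].
- have cp := mem_chart_at p.
  rewrite (uv _ d' p cp dp') (uv _ d p cp dp) (dmap_target cp dp dp').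
  by rewrite -!mulmxA cstruct_change.
- by rewrite (uv c d p cp dp); apply: realf.
Qed.

Lemma normal_field_orthogonal v :
  normal_field f v -> forall c d q, dom c q -> dom d (f q) ->
  v d q *m metric d (f q) *m (dmap f c d q)^T = 0.
Proof.
move=> [_ _ vn] c d q cq dq; apply/rowP => k; rewrite [RHS]mxE.
have := vn c d q (delta_mx 0 k) cq dq.
by rewrite /inner trmx_mul mulmxA trmx_delta -colE mxE.
Qed.

(** The vector field is -Jv, which is tangent by the assumption on dimensions;
    its components in a chart of N are recovered through the left inverse of
    the differential, which shows that they are smooth. *)
Lemma normal_field_vector v : normal_field f v ->
  exists2 u, vector_field u & cstruct_image u v.
Proof.
move=> vN; have vn := normal_field_orthogonal vN; have [vs vc _] := vN.
pose U c d q := - (v d q *m cstruct d (f q) *m metric d (f q)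
  *m (dmap f c d q)^T *m invmx (metric c q)).
have UE c d q : dom c q -> dom d (f q) ->
    U c d q *m dmap f c d q = - (v d q *m cstruct d (f q)).
  move=> cq dq; have Aq : pull_dom f c d q by [].
  have := normal_part_cstruct subf realf dim Aq (vn c d q cq dq).
  rewrite normal_partE tframe_gram // => /subr0_eq ->.
  by rewrite /U mulNmx !mulmxA.
have UJ c d q : dom c q -> dom d (f q) ->
    U c d q *m dmap f c d q *m cstruct d (f q) = v d q.
  move=> cq dq; rewrite UE // mulNmx -mulmxA cstruct_sqr //.
  by rewrite mulmxN mulmx1 opprK.
pose u c q := U c (chart_at (f q)) q.
have uv : cstruct_image u v.
  move=> c d q cq dq; have d0 := mem_chart_at (f q).
  rewrite (vc _ _ q d0 dq) -(UJ c _ q cq d0) (dmap_target cq d0 dq).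
  by rewrite -!mulmxA cstruct_change.
have uU c d q : dom c q -> dom d (f q) -> u c q = U c d q.
  move=> cq dq; apply: (dmap_inj cq dq); rewrite UE // (uv c d q cq dq).
  by rewrite -mulmxA cstruct_sqr // mulmxN mulmx1 opprK.
exists u => //; split=> [c k|c c' q cq cq'].
- apply: (proj1 (smooth_field_entries c _ (u c)) _ k) => {k} i k.
  apply: smooth_on_near => q0 cq0; pose d := chart_at (f q0).
  exists (pull_dom f c d); first by split => //; exact: mem_chart_at.
  have cA := open_in_pull c d fsm.
  move: i k; apply: (@smooth_mx_eq _ _ _ c _ cA _ _ _ (U c d)).
    by move=> q [cq dq]; exact: uU.
  apply: (smooth_mxN cA); apply: (smooth_mxM cA); last first.
    apply: (smooth_invmx cA) => [q [cq _]|i k]; first exact: metric_unit.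
    by apply: smooth_onW (@smooth_metric _ _ N c i k) => q [].
  apply: (smooth_mxM cA); last first.
    by apply: smooth_mxT; exact: smooth_D.
  apply: (smooth_mxM cA); last exact: smooth_G.
  apply: (smooth_mxM cA); last exact: smooth_J.
  by apply/smooth_field_entries => j; exact: vs.
- have d0 := mem_chart_at (f q).
  by apply: (dmap_inj cq' d0); rewrite -mulmxA -dmap_source // /u !UE.
Qed.

(** Combine the four identities above: the sums over the tangent frame of
    <K^M(e_i, u) u, e_i> cancel. *)
Lemma density_eq (minf : minimal f) u v p : vector_field u ->
  cstruct_image u v ->
  second_variation_density f v p = tangent_density f u p.
Proof.
move=> [us _] uv; rewrite /second_variation_density /tangent_density.
set c := chart_at p; set d := chart_at (f p).
have cp : dom c p := mem_chart_at p; have dp : dom d (f p) := mem_chart_at (f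
  p).
have Ap : pull_dom f c d p by [].
have su : smooth_mx c (pull_dom f c d) (u c).
  by apply/smooth_field_entries => j; apply: smooth_onW (us c j) => q [].
rewrite (normal_nabla_sqnormE subf realf dim Ap su); last first.
  by move=> q [cq dq]; exact: uv.
rewrite (uv c d p cp dp) (second_form_sqnormE subf realf dim Ap).
rewrite (ricci_gauss subf minf Ap) (ricci_lagrangian subf realf dim Ap).
ring.
Qed.

End fields.

(** * Stability *)

Theorem theorem5p1 (R : realType) (n : nat)
    (N : riemannian_manifold R n) (M : kaehler_manifold R (2 * n)%N)
    (f : N -> M) (mu : {measure set (borel N) -> \bar R}) :
  compact [set: N] -> connected [set: N] ->
  submanifold f -> minimal f -> totally_real f ->
  riemannian_volume mu ->
  stable f mu <->
  (forall u, vector_field u ->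
     (0 <= \int[mu]_(p in setT) (tangent_density f u p)%:E)%E).
Proof.
move=> _ _ subf minf realf _.
have dim : (n + n)%N = (2 * n)%N by rewrite addnn mul2n.
have same u v : vector_field u -> cstruct_image f u v ->
    (\int[mu]_(p in setT) (second_variation_density f v p)%:E
     = \int[mu]_(p in setT) (tangent_density f u p)%:E)%E.
  move=> uf uv; apply: eq_integral => p _.
  by rewrite (density_eq subf realf dim minf p uf uv).
split=> [st u uf|st v vf].
- have [v vf uv] := vector_field_normal subf realf uf.
  by rewrite -(same u v uf uv); exact: st.
- have [u uf uv] := normal_field_vector subf realf dim vf.
  by rewrite (same u v uf uv); exact: st.
Qed.
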